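(* Let $f:\mathbb{N}_+\to[0,1]$ be a non-increasing, summable envelope function. For any integer $p\ge1$ let $c(p)=\sum_{k=1}^p f(2k)$, and let $c(\infty)=\sum_{k\ge1}f(2k)$. Assume that $c(\infty)>1$. Let $p\in\mathbb{N}_+$ be such that $c(p)>1$. Let $n\in\mathbb{N}_+$, $\epsilon>0$ and $\lambda\in(0,1)$ be such that $n>\frac{c(p)}{f(2p)}\cdot\frac{10}{\epsilon(1-\lambda)}$. Then $$R^+(\Lambda_f^n)\ \ge\ C(p,n,\lambda,\epsilon)\sum_{i=1}^p\left(\frac12\log\frac{n(1-\lambda)\pi f(2i)}{2c(p)e}-\epsilon\right),$$ where $$C(p,n,\lambda,\epsilon)=\frac{1}{1+\frac{c(p)}{\lambda^2 n f(2p)}}\left(1-\frac4\pi\sqrt{\frac{5c(p)}{(1-\lambda)\epsilon n f(2p)}}\right).$$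
   Context: Logarithms are in base 2; $e$ is the base of natural logarithms; $\mathbb{N}_+=\{1,2,\dots\}$. The hypothesis on $n$ is understood to include $f(2p)>0$. A source on a countable alphabet $\mathcal{X}$ is a probability distribution $P$ on $\mathcal{X}^{\mathbb{N}}$; $P^n$ is the law of the first $n$ symbols and $\Lambda^n=\{P^n:P\in\Lambda\}$. A stationary memoryless source is one whose symbols are i.i.d. Throughout, only sources with finite Shannon entropy $H(X_{1:n})$ are considered. The envelope class $\Lambda_f$ is the collection of stationary memoryless sources $P$ on $\mathbb{N}_+$ with $P^1\{x\}\le f(x)$ for all $x\in\mathbb{N}_+$. With $\mathfrak{M}_1(\mathcal{X}^n)$ the set of probability distributions on $\mathcal{X}^n$ and $D(P^n,Q^n)=\sum_{\mathbf{x}}P^n(\mathbf{x})\log\frac{P^n(\mathbf{x})}{Q^n(\mathbf{x})}$, the minimax redundancy is $R^+(\Lambda^n)=\inf_{Q^n\in\mathfrak{M}_1(\mathcal{X}^n)}\sup_{P\in\Lambda}D(P^n,Q^n)$. *)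

(* Defs.v *)
From HB Require Import structures.
From mathcomp Require Import all_boot all_order all_algebra.
From mathcomp Require Import all_classical all_reals all_analysis.
Set Implicit Arguments.
Unset Strict Implicit.
Unset Printing Implicit Defensive.
Import Order.TTheory GRing.Theory Num.Theory.
Import numFieldNormedType.Exports.

Local Open Scope classical_set_scope.
Local Open Scope ring_scope.

Definition posnat := {x : nat | (0 < x)%N}.

HB.instance Definition _ := Countable.on posnat.
HB.instance Definition _ := isPointed.Build posnat (exist _ 1%N isT).
HB.instance Definition _ := @isMeasurable.Build default_measure_display
  posnat discrete_measurable discrete_measurable0
  discrete_measurableC discrete_measurableU.

(* Sequences are indexed from 0: [w 0] is the first symbol. *)
Definition cylinders : set (set (nat -> posnat)) :=
  [set C | exists i (A : set posnat), C = [set w | A (w i)]].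

Definition source (R : realType) :=
  probability (g_sigma_algebraType cylinders) R.

(* As [posnat] is countable and discrete, the sigma-algebra of
   [n.-tuple posnat] contains every subset. *)
Definition block n (w : g_sigma_algebraType cylinders) : n.-tuple posnat :=
  [tuple w i | i < n].

Definition block_law (R : realType) (P : source R) n :
    set (n.-tuple posnat) -> \bar R :=
  pushforward P (@block n).
Arguments block_law {R} P n _.

Definition block_laws (R : realType) (L : set (source R)) n :
    set (set (n.-tuple posnat) -> \bar R) :=
  [set block_law P n | P in L].
Arguments block_laws {R} L n _.

(* Taking some of the [A i] to be [setT] gives the product rule for every
   finite subfamily of the symbols. *)
Definition memoryless (R : realType) (P : source R) : Prop :=
  (forall (i : nat) (A : set posnat),
     P [set w | A (w i)] = P [set w | A (w 0%N)]) /\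
  (forall (n : nat) (A : nat -> set posnat),
     P [set w | forall i, (i < n)%N -> A i (w i)] =
     (\prod_(i < n) P [set w | A i (w i)])%E).

Definition log2 (R : realType) (x : R) : R := ln x / ln 2.

(* 0 log 0 = 0, since [ln 0 = 0]. *)
Definition entropy (R : realType) (P : source R) (n : nat) : \bar R :=
  \esum_(x in [set: n.-tuple posnat])
    (let p := fine (block_law P n [set x]) in (- (p * log2 p))%:E).

(* p log (p / q), with the conventions 0 log (0 / q) = 0 and, for p > 0,
   p log (p / 0) = +oo. *)
Definition divergence_term (R : realType) (p q : R) : \bar R :=
  if p == 0 then 0%E else if q == 0 then +oo%E else (p * log2 (p / q))%:E.

(* [esum] is meant for nonnegative terms, hence the split. For probability
   distributions the negative part is summable, so the difference is never
   the indeterminate form +oo - +oo. *)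
Definition divergence (R : realType) n (P Q : set (n.-tuple posnat) -> \bar R) :
    \bar R :=
  let t := fun x => divergence_term (fine (P [set x])) (fine (Q [set x])) in
  (\esum_(x in [set: n.-tuple posnat]) (t^\+ x)
   - \esum_(x in [set: n.-tuple posnat]) (t^\- x))%E.

Definition minimax_redundancy (R : realType) n
    (M : set (set (n.-tuple posnat) -> \bar R)) : \bar R :=
  ereal_inf [set ereal_sup [set divergence P Q | P in M]
            | Q in [set: probability (n.-tuple posnat) R]].

(* Only the values of [f] at positive integers matter. *)
Definition envelope_class (R : realType) (f : nat -> R) : set (source R) :=
  [set P | [/\ memoryless P,
               forall n, (entropy P n < +oo)%E &
               forall x : posnat,
                 (block_law P 1 [set [tuple x]] <= (f (val x))%:E)%E]].

Definition csum (R : realType) (f : nat -> R) (p : nat) : R :=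
  \sum_(1 <= k < p.+1) f (2 * k)%N.

Definition Cconst (R : realType) (f : nat -> R) (p n : nat) (lam eps : R) : R :=
  1 / (1 + csum f p / (lam ^+ 2 * n%:R * f (2 * p)%N)) *
  (1 - 4 / pi *
     Num.sqrt (5 * csum f p / ((1 - lam) * eps * n%:R * f (2 * p)%N))).

(* Main.v *)
Require Import Defs.
From HB Require Import structures.
From mathcomp Require Import all_boot all_order all_algebra.
From mathcomp Require Import all_classical all_reals all_analysis.
From mathcomp Require Import ring lra.
Set Implicit Arguments.
Unset Strict Implicit.
Unset Printing Implicit Defensive.
Import Order.TTheory GRing.Theory Num.Theory.
Import numFieldNormedType.Exports.
Local Open Scope classical_set_scope.
Local Open Scope ring_scope.

(** The minimax redundancy is at least the Bayes redundancy of any prior on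
    the class ([minimax_redundancy_ge_bayes]): the supremum over the class
    dominates an average, and the average of the divergences to [Q] exceeds
    the mutual information between parameter and word by the divergence of
    the mixture from [Q].

    Write [c] for [csum f p].  The parameters are the vectors [theta] of
    [p] numbers between 0 and 1: the pair of symbols 2i - 1 and 2i receives
    the mass [m_i = f(2i) / c], split between the two symbols in the
    proportions [theta_i] and [1 - theta_i].  As [c > 1] and [f] is
    non-increasing, these laws obey the envelope ([iid_source_envelope]).  For a product prior the
    information decomposes: the pair [i] is visited [N_i] times, [N_i] being
    binomial of parameters [n] and [m_i], and each visit is a toss of a coin
    of bias [theta_i].  So the information is the sum over [i] of the mean of
    [I(N_i)], where [I(k)] is the information that [k] tosses give about the
    bias ([urn_marginal], [urn_entropy]).

    With the arcsine (Jeffreys) law as prior for the bias, a given sequence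
    of [j] heads and [l] tails has the Krichevsky-Trofimov probability
    [kt j l], and the number of heads among [k] tosses is the number of draws
    of one colour from a Polya urn.  The Wallis and Stirling bounds, whose
    errors all have the favourable sign, give
    [- ln (kt j (k - j)) >= ln (pi k / 2) / 2 + k h(j / k)] ([kt_ln_ge]), [h]
    being the binary entropy.  The mean of [h(j / k)] is less than the mean
    entropy of the coin by at most [1 / (2k)] ([mean_entropy_gap]): this
    produces the number [e] in
    [I(k) >= ln (pi k / (2 e)) / 2] ([kt_redundancy_ge]), which holds for
    every [k >= 1] without any error term.  Hence the bound is obtained with
    [epsilon = 0] and without the second factor of the constant, and both can
    be reintroduced because that factor lies between 0 and 1.  The first
    factor comes from a one-sided Chebyshev inequality, which says that [N_i]
    exceeds [(1 - lambda) n m_i] with probability at least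
    [1 / (1 + 1 / (lambda^2 n m_i))] ([bin_mean_cantelli]).

    The prior is kept finite: the bias is [t / K], where [t] follows the law
    of the number of heads among [K] tosses of the urn itself.  Its moments
    tend to the Krichevsky-Trofimov probabilities as [K] grows
    ([moment_cvg]), and the mean entropy of such a coin is literally
    [mean_entropy K], the quantity that [mean_entropy_gap] controls.  All
    computations are then finite sums, followed by a single limit for fixed
    [n] ([mixture_information_ge]).

    Finally, the memoryless sources of the class must exist as laws on
    infinite sequences: they are obtained as the law of the digits of a
    uniform real number in the numeration attached to a partition of the unit
    interval ([digits_cylP], [iid_source]). *)

(** * The discrete arcsine law *)

Section Urn.
Variable R : realType.
Implicit Types F : nat -> R.

(** The Pochhammer symbol (1/2)_j. *)
Definition half_rising (j : nat) : R := \prod_(i < j) (i%:R + 2^-1).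

(** This is the probability 4^-j 'C(2j, j) that a symmetric walk is back at
    the origin at time 2j. *)
Definition central (j : nat) : R := half_rising j / j`!%:R.

(** The law of the number of heads in [k] tosses of a coin whose bias follows
    the arcsine law. *)
Definition arcsine_weight (k j : nat) : R := central j * central (k - j).

Definition arcsine_mean (k : nat) F : R :=
  \sum_(j < k.+1) arcsine_weight k j * F j.

Lemma half_risingS j : half_rising j.+1 = half_rising j * (j%:R + 2^-1).
Proof. by rewrite /half_rising big_ord_recr. Qed.

Lemma half_rising0 : half_rising 0 = 1.
Proof. by rewrite /half_rising big_ord0. Qed.

Lemma half_rising_gt0 j : 0 < half_rising j.
Proof.
apply: prodr_gt0 => i _; rewrite ltr_wpDl ?ler0n// invr_gt0; exact: ltr0n.
Qed.

Lemma fact_neq0 (j : nat) : j`!%:R != 0 :> R.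
Proof. by rewrite pnatr_eq0 -lt0n fact_gt0. Qed.

Lemma central_gt0 j : 0 < central j.
Proof. by rewrite divr_gt0 ?half_rising_gt0 ?ltr0n ?fact_gt0. Qed.

Lemma central0 : central 0 = 1.
Proof. by rewrite /central half_rising0 fact0 divr1. Qed.

Lemma centralS j : j.+1%:R * central j.+1 = (j%:R + 2^-1) * central j.
Proof.
rewrite /central half_risingS factS natrM; have := fact_neq0 j.
have : j.+1%:R != 0 :> R by rewrite pnatr_eq0.
by move=> *; field; apply/andP.
Qed.

Lemma arcsine_weight_ge0 k j : 0 <= arcsine_weight k j.
Proof. by rewrite mulr_ge0 ?ltW ?central_gt0. Qed.

(** The tosses are draws from a Polya urn that starts with half a ball of each
    colour.  Writing [k + 1] as [j + (k + 1 - j)] splits the weight of [j] at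
    time [k + 1] into the contributions of [j - 1] and of [j] at time [k]. *)
Lemma arcsine_mean_urn k F :
  arcsine_mean k.+1 F = arcsine_mean k (fun j =>
    ((j%:R + 2^-1) * F j.+1 + ((k - j)%:R + 2^-1) * F j) / k.+1%:R).
Proof.
have k1 : k.+1%:R != 0 :> R by rewrite pnatr_eq0.
apply: (mulfI k1); rewrite /arcsine_mean !mulr_sumr.
have -> : \sum_(i < k.+2) k.+1%:R * (arcsine_weight k.+1 i * F i) =
    \sum_(i < k.+2) (i%:R * arcsine_weight k.+1 i * F i) +
    \sum_(i < k.+2) ((k.+1 - i)%:R * arcsine_weight k.+1 i * F i).
  rewrite -big_split/=; apply: eq_bigr => i _.
  rewrite natrB; last by rewrite -ltnS.
  ring.
rewrite big_ord_recl /= !mul0r add0r.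
rewrite [X in _ + X = _]big_ord_recr /= subnn !mul0r addr0 -big_split/=.
apply: eq_bigr => i _.
have ik : (i <= k)%N by rewrite -ltnS.
rewrite /arcsine_weight /bump /= add1n subSS subSn//.
have := centralS i; have := centralS (k - i).
set a := central i.+1; set b := central i; set c := central (k - i).+1.
set d := central (k - i) => E1 E2.
rewrite mulrA E2 (mulrC b c) [_ * (c * b)]mulrA E1.
by field.
Qed.

Lemma arcsine_mean_ext k F1 F2 : (forall j, (j <= k)%N -> F1 j = F2 j) ->
  arcsine_mean k F1 = arcsine_mean k F2.
Proof.
by move=> H; apply: eq_bigr => j _; rewrite H// -ltnS.
Qed.

Lemma arcsine_mean_le k F1 F2 : (forall j, (j <= k)%N -> F1 j <= F2 j) ->
  arcsine_mean k F1 <= arcsine_mean k F2.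
Proof.
move=> H; apply: ler_sum => j _.
by rewrite ler_wpM2l ?arcsine_weight_ge0// H// -ltnS.
Qed.

Lemma arcsine_meanD k F1 F2 :
  arcsine_mean k (fun j => F1 j + F2 j) = arcsine_mean k F1 + arcsine_mean k F2.
Proof.
by rewrite /arcsine_mean -big_split/=; apply: eq_bigr => j _; rewrite mulrDr.
Qed.

Lemma arcsine_meanZ k c F :
  arcsine_mean k (fun j => c * F j) = c * arcsine_mean k F.
Proof.
by rewrite /arcsine_mean mulr_sumr; apply: eq_bigr => j _; rewrite mulrCA.
Qed.

Lemma arcsine_mean1 k : arcsine_mean k (fun=> 1) = 1.
Proof.
elim: k => [|k IHk].
  by rewrite /arcsine_mean big_ord1 /arcsine_weight subnn central0 !mulr1.
rewrite arcsine_mean_urn -[RHS]IHk; apply: arcsine_mean_ext => j jk.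
have k1 : k%:R + 1 != 0 :> R by rewrite natr1 pnatr_eq0.
by rewrite natrB// -natr1; field.
Qed.

Lemma arcsine_mean_cst k c : arcsine_mean k (fun=> c) = c.
Proof.
rewrite -[RHS]mulr1 -(arcsine_mean1 k) -arcsine_meanZ.
by apply: arcsine_mean_ext => j _; rewrite mulr1.
Qed.

Lemma arcsine_mean_sym k F :
  arcsine_mean k (fun j => F (k - j)%N) = arcsine_mean k F.
Proof.
rewrite /arcsine_mean (reindex_inj rev_ord_inj)/=; apply: eq_bigr => j _.
have jk : (j <= k)%N by rewrite -ltnS.
by rewrite subSS subKn// /arcsine_weight subKn// mulrC [in RHS]mulrC
  [central (_ - _) * _]mulrC.
Qed.

Definition harm (k : nat) : R := \sum_(i < k) (i.+1%:R)^-1.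
(** Up to an additive constant this is the digamma function at [j + 1/2], the
    substitute for [ln j] whose means under the urn are explicit. *)
Definition half_harm (j : nat) : R := \sum_(i < j) (i%:R + 2^-1)^-1.

Lemma harmS k : harm k.+1 = harm k + (k.+1%:R)^-1.
Proof. by rewrite /harm big_ord_recr. Qed.
Lemma half_harmS k : half_harm k.+1 = half_harm k + (k%:R + 2^-1)^-1.
Proof. by rewrite /half_harm big_ord_recr. Qed.

Lemma natr_half_neq0 (j : nat) : j%:R + 2^-1 != 0 :> R.
Proof. by rewrite gt_eqF// ltr_wpDl ?ler0n// invr_gt0; exact: ltr0n. Qed.

Lemma arcsine_mean_id k : arcsine_mean k (fun j => j%:R) = k%:R / 2.
Proof.
have H : arcsine_mean k (fun j => j%:R) + arcsine_mean k (fun j => (k - j)%:R)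
   = k%:R.
  rewrite -arcsine_meanD -[RHS](arcsine_mean_cst k).
  by apply: arcsine_mean_ext => j jk; rewrite -natrD subnKC.
move: H; rewrite (arcsine_mean_sym k (fun j => j%:R)) => H.
lra.
Qed.

(** A draw multiplies the increment 1 / (j + 1/2) by the probability
    (j + 1/2) / (k + 1), so the mean grows by 1 / (k + 1) whatever [j]. *)
Lemma arcsine_mean_half_harm k : arcsine_mean k half_harm = harm k.
Proof.
elim: k => [|k IHk].
  rewrite /arcsine_mean big_ord1 /arcsine_weight subnn central0.
  by rewrite /half_harm /harm !big_ord0 mulr0.
have k1 : k%:R + 1 != 0 :> R by rewrite natr1 pnatr_eq0.
rewrite arcsine_mean_urn harmS -IHk -[X in _ = _ + X](arcsine_mean_cst k).
rewrite -arcsine_meanD; apply: arcsine_mean_ext => j jk.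
rewrite natrB// half_harmS -natr1; have := natr_half_neq0 j.
move=> *; field; apply/andP; split => //; lra.
Qed.

(** The closed form that the mean of [j ln j] lacks. *)
Lemma arcsine_mean_id_half_harm k :
  arcsine_mean k (fun j => j%:R * half_harm j) = k%:R / 2 * (harm k + 1).
Proof.
elim: k => [|k IHk].
  rewrite /arcsine_mean big_ord1 /arcsine_weight subnn central0.
  by rewrite !mul0r mulr0.
have k1 : k%:R + 1 != 0 :> R by rewrite natr1 pnatr_eq0.
rewrite arcsine_mean_urn.
have -> : arcsine_mean k (fun j =>
     ((j%:R + 2^-1) * (j.+1%:R * half_harm j.+1)
       + ((k - j)%:R + 2^-1) * (j%:R * half_harm j)) / k.+1%:R) =
  arcsine_mean k (fun j => (1 + (k.+1%:R)^-1) * (j%:R * half_harm j)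
   + ((k.+1%:R)^-1 * 2^-1 * half_harm j + ((k.+1%:R)^-1 * j%:R + (k.+1%:R)^-1))).
  apply: arcsine_mean_ext => j jk.
  rewrite natrB// half_harmS -!natr1; have := natr_half_neq0 j.
  move=> *; field; apply/andP; split => //; lra.
rewrite arcsine_meanD arcsine_meanZ IHk arcsine_meanD arcsine_meanZ.
rewrite arcsine_mean_half_harm arcsine_meanD arcsine_meanZ arcsine_mean_id.
rewrite arcsine_mean_cst harmS -natr1; field; lra.
Qed.

End Urn.

(** * The mean entropy under the discrete arcsine law *)

Section Logs.
Variable R : realType.
Implicit Types x y a b : R.

Lemma ge0_derive_le (g dg : R -> R) a b : a <= b ->
  (forall x, a <= x <= b -> is_derive x 1 g (dg x)) ->
  (forall x, a <= x <= b -> 0 <= dg x) -> g a <= g b.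
Proof.
move=> ab dgP dg0.
have [x|x|c] := @MVT_segment R g dg a b ab.
- by rewrite in_itv/= => /andP[/ltW ax /ltW xb]; apply: dgP; rewrite ax.
- apply: derivable_within_continuous => {}x; rewrite in_itv/= => axb.
  by have [] := dgP x axb.
- rewrite in_itv/= => cab E; rewrite -subr_ge0 E mulr_ge0 ?dg0//.
  by rewrite subr_ge0.
Qed.

Lemma ln_ge_1BV y : 0 < y -> 1 - y^-1 <= ln y.
Proof.
move=> y0; have := @le_ln1Dx R (y^-1 - 1).
rewrite ltrDr invr_gt0 y0 addrC subrK lnV// => /(_ isT); lra.
Qed.

(** The midpoint rule underestimates the integral of 1 / t from 1 to [y]. *)
Lemma ln_midpoint y : 1 <= y -> 2 * (y - 1) <= (y + 1) * ln y.
Proof.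
move=> y1; rewrite -subr_ge0.
pose g (x : R) := (x + 1) * ln x - 2 * (x - 1).
have -> : 0 = g 1 by rewrite /g ln1 subrr !mulr0 subr0.
apply: (@ge0_derive_le g (fun x => ln x + (x + 1) * x^-1 - 2) _ _ y1);
  move=> x /andP[x1 _].
- have x0 : 0 < x by lra.
  have := is_derive1_ln x0 => dln.
  rewrite /g; apply: is_derive_eq.
  rewrite /GRing.scale/=; lra.
- have x0 : 0 < x by lra.
  have := ln_ge_1BV x0; rewrite mulrDl divff ?gt_eqF// mul1r; lra.
Qed.

(** The trapezoid rule overestimates the integral of 1 / t from 1 to [y]. *)
Lemma ln_trapezoid y : 1 <= y -> 2 * y * ln y <= y ^+ 2 - 1.
Proof.
move=> y1; rewrite -subr_ge0.
pose g (x : R) := x ^+ 2 - 1 - 2 * x * ln x.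
have -> : 0 = g 1 by rewrite /g ln1 mulr0 subr0 expr1n subrr.
apply: (@ge0_derive_le g (fun x => 2 * x - 2 * ln x - 2) _ _ y1);
  move=> x /andP[x1 _].
- have x0 : 0 < x by lra.
  have := is_derive1_ln x0 => dln.
  rewrite /g; apply: is_derive_eq.
  rewrite /GRing.scale/=.
  have x0' : x != 0 by rewrite gt_eqF.
  by field.
- have := @le_ln1Dx R (x - 1); rewrite (addrC 1) subrK => H.
  have : ln x <= x - 1 by apply: H; lra.
  lra.
Qed.

Lemma ln_succ_ge (k : nat) : (0 < k)%N ->
  (k%:R + 2^-1)^-1 <= ln k.+1%:R - ln k%:R :> R.
Proof.
move=> k0; have k0' : (0:R) < k%:R by rewrite ltr0n.
rewrite -ln_div ?posrE ?ltr0n//.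
have := @ln_midpoint (k.+1%:R / k%:R).
rewrite ler_pdivlMr// mul1r ler_nat leqnSn => /(_ isT).
set L := ln _.
have -> : 2 * (k.+1%:R / k%:R - 1) = 2 / k%:R :> R.
  by rewrite -natr1; field; rewrite gt_eqF.
have -> : k.+1%:R / k%:R + 1 = 2 * (k%:R + 2^-1) / k%:R :> R.
  by rewrite -natr1; field; rewrite gt_eqF.
have a0 : (0:R) < k%:R + 2^-1 by rewrite ltr_wpDl ?ler0n// invr_gt0 ltr0n.
move=> H; rewrite -[leLHS]mul1r ler_pdivrMr// mulrC.
have k2 : (0:R) < 2 / k%:R by rewrite divr_gt0.
by rewrite -(ler_pM2l k2) mulr1 mulrA [2 / _ * _]mulrAC.
Qed.

Lemma ln_succ_le (k : nat) : (0 < k)%N ->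
  ln k.+1%:R - ln k%:R <= (k%:R^-1 + k.+1%:R^-1) / 2 :> R.
Proof.
move=> k0; have k0' : (0:R) < k%:R by rewrite ltr0n.
have k1' : (0:R) < k%:R + 1 by lra.
rewrite -ln_div ?posrE ?ltr0n//.
have := @ln_trapezoid (k.+1%:R / k%:R).
rewrite ler_pdivlMr// mul1r ler_nat leqnSn => /(_ isT).
set L := ln _.
have -> : (k.+1%:R / k%:R) ^+ 2 - 1 =
   2 * (k.+1%:R / k%:R) * ((k%:R^-1 + k.+1%:R^-1) / 2) :> R.
  by rewrite -natr1; field; rewrite !gt_eqF.
by rewrite ler_pM2l// mulr_gt0 ?divr_gt0 ?ltr0n.
Qed.

Definition log_defect (j : nat) : R := ln j%:R - half_harm R j.

Lemma log_defect_mono i j : (0 < i)%N -> (i <= j)%N ->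
  log_defect i <= log_defect j.
Proof.
move=> i0 /subnK <-; elim: (j - i)%N => [//|m IH].
apply: (le_trans IH); rewrite /log_defect addSn half_harmS.
have := @ln_succ_ge (m + i)%N; rewrite ltn_addl// => /(_ isT); lra.
Qed.

(** [log_defect] increases to a finite limit, and its value at [i] is within
    1 / (2i) of that limit. *)
Lemma log_defect_gap i j : (0 < i)%N -> (i <= j)%N ->
  log_defect j - (2 * i%:R)^-1 <= log_defect i.
Proof.
move=> i0 ij.
suff : log_defect j + (2 * j%:R)^-1 <= log_defect i + (2 * i%:R)^-1.
  have : (0:R) <= (2 * j%:R)^-1 by rewrite invr_ge0 mulr_ge0.
  lra.
move/subnK: ij => <-; elim: (j - i)%N => [//|m IH].
apply: le_trans IH; rewrite /log_defect addSn half_harmS.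
set k := (m + i)%N.
have k0 : (0 < k)%N by rewrite ltn_addl.
have kR : (0:R) < k%:R by rewrite ltr0n.
have := ln_succ_le k0; rewrite -natr1.
have H : (k%:R^-1 + (k%:R + 1)^-1) / 2 - (k%:R + 2^-1)^-1 <=
    (2 * k%:R)^-1 - (2 * (k%:R + 1))^-1 :> R.
  rewrite -subr_ge0.
  have -> : (2 * k%:R)^-1 - (2 * (k%:R + 1))^-1 -
      ((k%:R^-1 + (k%:R + 1)^-1) / 2 - (k%:R + 2^-1)^-1) =
      (k%:R + 2^-1)^-1 - (k%:R + 1)^-1 :> R.
    by field; rewrite !gt_eqF//; lra.
  rewrite subr_ge0 lef_pV2 ?posrE; lra.
lra.
Qed.

(** [harm k - ln k] decreases to the Euler constant; by the trapezoid rule the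
    correction 1 / (2k) is enough to reverse its monotonicity. *)
Lemma harm_ln_mono i j : (0 < i)%N -> (i <= j)%N ->
  harm R i - ln i%:R - (2 * i%:R)^-1 <= harm R j - ln j%:R - (2 * j%:R)^-1.
Proof.
move=> i0 /subnK <-; elim: (j - i)%N => [//|m IH].
apply: (le_trans IH); rewrite addSn harmS.
set k := (m + i)%N.
have k0 : (0 < k)%N by rewrite ltn_addl.
have := ln_succ_le k0; rewrite !invfM -(natr1 k); lra.
Qed.

Definition bin_entropy (x : R) : R := - (x * ln x) - (1 - x) * ln (1 - x).

Definition mean_entropy (k : nat) : R :=
  arcsine_mean k (fun j => bin_entropy (j%:R / k%:R)).

Lemma mul_ln_div (j k : nat) : (0 < k)%N ->
  j%:R / k%:R * ln (j%:R / k%:R) = k%:R^-1 * (j%:R * ln j%:R - j%:R * ln k%:R) :> R.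
Proof.
move=> k0; case: j => [|j]; first by rewrite !mul0r subrr mulr0.
by rewrite ln_div ?posrE ?ltr0n//; field; rewrite pnatr_eq0 -lt0n.
Qed.

Lemma bin_entropy_frac (j k : nat) : (0 < k)%N -> (j <= k)%N ->
  k%:R * bin_entropy (j%:R / k%:R) =
  k%:R * ln k%:R - j%:R * ln j%:R - (k - j)%:R * ln (k - j)%:R.
Proof.
move=> k0 jk; rewrite /bin_entropy.
have kN : k%:R != 0 :> R by rewrite pnatr_eq0 -lt0n.
have -> : 1 - j%:R / k%:R = (k - j)%:R / k%:R :> R.
  by rewrite natrB//; field.
rewrite !mul_ln_div// natrB//; field.
by [].
Qed.

Lemma mean_entropyE k : (0 < k)%N ->
  mean_entropy k = ln k%:R - 2 / k%:R * arcsine_mean k (fun j => j%:R * ln j%:R).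
Proof.
move=> k0; have kN : k%:R != 0 :> R by rewrite pnatr_eq0 -lt0n.
apply: (mulfI kN); rewrite /mean_entropy -arcsine_meanZ.
transitivity (arcsine_mean k (fun j => (k%:R * ln k%:R : R) +
   ((-1) * (j%:R * ln j%:R) + (-1) * ((k - j)%:R * ln (k - j)%:R)))).
  by apply: arcsine_mean_ext => j jk; rewrite bin_entropy_frac//; ring.
rewrite !arcsine_meanD !arcsine_meanZ arcsine_mean_cst.
rewrite (arcsine_mean_sym k (fun j => j%:R * ln j%:R)).
by field.
Qed.

Lemma mean_entropy_harm k : (0 < k)%N ->
  mean_entropy k = ln k%:R - harm R k - 1 -
    2 / k%:R * arcsine_mean k (fun j => j%:R * log_defect j).
Proof.
move=> k0; have kN : k%:R != 0 :> R by rewrite pnatr_eq0 -lt0n.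
rewrite mean_entropyE//.
have -> : arcsine_mean k (fun j => j%:R * ln j%:R) =
  arcsine_mean k (fun j => j%:R * log_defect j + j%:R * half_harm R j).
  by apply: arcsine_mean_ext => j _; rewrite /log_defect; ring.
by rewrite arcsine_meanD arcsine_mean_id_half_harm; field.
Qed.

(** As [k] grows, [mean_entropy k] increases to the mean entropy of a coin with
    arcsine bias, and the remaining gap is essentially 1 / (2k).  In the form
    [mean_entropy_harm] the only inexplicit term is the size-biased mean of
    [log_defect]: at [k] it is at most [log_defect k] by monotonicity, and at
    [K] it is at least that up to 1 / K by [log_defect_gap].  What remains is
    the comparison of [harm k - ln k] with [harm K - ln K]. *)
Lemma mean_entropy_gap k K : (0 < k)%N -> (k <= K)%N ->
  mean_entropy K <= mean_entropy k + (2 * k%:R)^-1 + (2 * K%:R)^-1.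
Proof.
move=> k0 kK; have K0 := leq_trans k0 kK.
have kP : (0:R) < k%:R by rewrite ltr0n.
have KP : (0:R) < K%:R by rewrite ltr0n.
rewrite !mean_entropy_harm//.
have Hk : 2 / k%:R * arcsine_mean k (fun j => j%:R * log_defect j) <= log_defect k.
  have -> : log_defect k = 2 / k%:R * arcsine_mean k (fun j => log_defect k * j%:R).
    by rewrite arcsine_meanZ arcsine_mean_id; field; rewrite gt_eqF.
  rewrite ler_pM2l ?divr_gt0//.
  apply: arcsine_mean_le => -[|j] jk; first by rewrite mul0r mulr0.
  by rewrite mulrC ler_pM2r ?ltr0n// log_defect_mono.
have HK : log_defect k - K%:R^-1 <=
    2 / K%:R * arcsine_mean K (fun j => j%:R * log_defect j).
  have -> : log_defect k - K%:R^-1 =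
     2 / K%:R * arcsine_mean K (fun j => log_defect k * j%:R + - 2^-1).
    rewrite arcsine_meanD arcsine_meanZ arcsine_mean_id arcsine_mean_cst.
    by field; rewrite gt_eqF.
  rewrite ler_pM2l ?divr_gt0//.
  apply: arcsine_mean_le => -[|j] jK; first by rewrite mul0r mulr0; lra.
  have jP : (0:R) < j.+1%:R by rewrite ltr0n.
  have [jk|kj] := leqP j.+1 k.
    have := log_defect_gap (ltn0Sn j) jk.
    rewrite -(ler_pM2l jP) mulrBr (_ : _ * (2 * _)^-1 = 2^-1); first lra.
    by field; rewrite gt_eqF.
  have := log_defect_mono k0 (ltnW kj); rewrite -(ler_pM2l jP); lra.
have := harm_ln_mono k0 kK; rewrite !invfM.
rewrite -[leLHS]addrA.
lra.
Qed.

End Logs.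

(** * The Wallis bounds *)

Section Wallis.
Variable R : realType.

(** Primitives of the powers of cosine, built two at a time because the
    reduction formula has step two. *)
Fixpoint cos_pow_prim2 (n : nat) : (R -> R) * (R -> R) :=
  if n is m.+1 then
    let: (P0, P1) := cos_pow_prim2 m in
    (P1, fun x => (sin x * cos x ^+ n + n%:R * P0 x) / n.+1%:R)
  else (id, sin).

Definition cos_pow_prim n := (cos_pow_prim2 n).1.

Lemma cos_pow_primSS n x : cos_pow_prim n.+2 x =
  (sin x * cos x ^+ n.+1 + n.+1%:R * cos_pow_prim n x) / n.+2%:R.
Proof. by rewrite /cos_pow_prim /=; case: (cos_pow_prim2 n). Qed.

Lemma cos_pow_prim_derive (n : nat) (x : R) :
  is_derive x 1 (cos_pow_prim n) (cos x ^+ n).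
Proof.
suff : is_derive x 1 (cos_pow_prim n) (cos x ^+ n) /\
       is_derive x 1 (cos_pow_prim n.+1) (cos x ^+ n.+1) by case.
elim: n => [|n [IH0 IH1]].
  split; first by rewrite expr0; exact: is_derive_id.
  by rewrite expr1; exact: is_derive_sin.
split => //.
have -> : cos_pow_prim n.+2 = (n.+2%:R^-1 : R) \*:
   ((sin : R -> R) * (cos : R -> R) ^+ n.+1 + (n.+1%:R : R) \*: cos_pow_prim n).
  apply/funext => y; rewrite cos_pow_primSS /= mulrC.
  by rewrite /GRing.scale/= addrfctE mulrfctE exprfctE.
have h := is_deriveZ n.+2%:R^-1 (is_deriveD
  (is_deriveM (is_derive_sin x) (is_deriveX n.+1 (is_derive_cos x)))
  (is_deriveZ n.+1%:R IH0)).
apply: (is_derive_eq h).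
rewrite /GRing.scale/= exprfctE !exprS -!natr1.
have := cos2Dsin2 x.
set c := cos x; set s := sin x; set C := c ^+ n; move=> E.
have n0 : (0:R) <= n%:R by rewrite ler0n.
have s2 : s * s = 1 - c ^+ 2 by rewrite -E; ring.
transitivity ((n%:R + 1 + 1)^-1 *
  (- ((n%:R + 1) * C * (s * s)) + c * C * c + (n%:R + 1) * C)); first by ring.
by rewrite s2; field; lra.
Qed.

Lemma cos_pow_prim_at0 n : cos_pow_prim n (0 : R) = 0.
Proof.
suff : cos_pow_prim n (0 : R) = 0 /\ cos_pow_prim n.+1 (0 : R) = 0 by case.
elim: n => [|n [IH0 IH1]]; first by split => //; exact: sin0.
by split => //; rewrite cos_pow_primSS IH0 sin0 mul0r mulr0 addr0 mul0r.
Qed.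

(** The integral of [cos x ^+ n] from 0 to pi / 2. *)
Definition wallis n : R := cos_pow_prim n (pi / 2).

Lemma wallisSS n : n.+2%:R * wallis n.+2 = n.+1%:R * wallis n.
Proof.
rewrite /wallis cos_pow_primSS cos_pihalf expr0n/= mulr0 add0r.
by rewrite mulrC divfK ?pnatr_eq0.
Qed.

Lemma wallis_le n : wallis n.+1 <= wallis n.
Proof.
have pi0 : 0 <= pi / 2 :> R by rewrite divr_ge0 ?pi_ge0.
rewrite -subr_ge0.
pose g : R -> R := cos_pow_prim n - cos_pow_prim n.+1.
have -> : 0 = g 0 by rewrite /g /= !fctE !cos_pow_prim_at0 subrr.
apply: (@ge0_derive_le R g (fun x => cos x ^+ n - cos x ^+ n.+1) _ _ pi0);
  move=> x /andP[x0 xpi].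
  exact: (is_deriveB (cos_pow_prim_derive n x) (cos_pow_prim_derive n.+1 x)).
have c0 : 0 <= cos x.
  by apply: cos_ge0_pihalf; rewrite xpi andbT (le_trans _ x0)// oppr_le0.
by rewrite subr_ge0 exprS ler_piMl ?exprn_ge0// cos_le1.
Qed.

Lemma wallis_even k : wallis k.*2 = pi / 2 * central R k.
Proof.
elim: k => [|k IH]; first by rewrite central0 mulr1.
have k1 : k.*2.+2%:R != 0 :> R by rewrite pnatr_eq0.
apply: (mulfI k1); rewrite doubleS wallisSS IH.
have := centralS R k; rewrite -!natr1 -mul2n natrM => E.
transitivity (pi * ((k%:R + 1) * central R k.+1)); first by rewrite E; field.
by field.
Qed.

Lemma wallis_odd k : k.*2.+1%:R * central R k * wallis k.*2.+1 = 1.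
Proof.
elim: k => [|k IH].
  by rewrite central0 !mul1r /wallis /cos_pow_prim/= sin_pihalf.
have k1 : k.+1%:R != 0 :> R by rewrite pnatr_eq0.
rewrite doubleS mulrAC wallisSS.
have := centralS R k; move: IH; rewrite -!natr1 -mul2n natrM => IH E.
rewrite -[RHS]IH; apply: (mulfI k1); rewrite -!natr1.
transitivity (2 * (k%:R + 1) * wallis (2 * k).+1 * ((k%:R + 1) * central R k.+1)).
  by ring.
by rewrite E; field.
Qed.

(** The Wallis integral of index 2k is at most that of index 2k - 1, and
    [wallis_even] and [wallis_odd] evaluate both. *)
Lemma central_wallis_le k : pi * k%:R * central R k ^+ 2 <= 1.
Proof.
case: k => [|k]; first by rewrite mulr0 mul0r.
have := wallis_le k.*2.+1; rewrite -doubleS wallis_even.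
have k0 : 0 <= k.*2.+1%:R * central R k by rewrite mulr_ge0 ?ler0n ?ltW ?central_gt0.
move=> /(ler_wpM2l k0); rewrite wallis_odd; apply: le_trans.
have := centralS R k; rewrite -!natr1 -mul2n natrM => E.
rewrite le_eqVlt; apply/orP; left; apply/eqP.
transitivity (pi * central R k.+1 * ((k%:R + 1) * central R k.+1)); first by ring.
by rewrite E; field.
Qed.

Lemma central_wallis_ge k : 2 <= pi * k.*2.+1%:R * central R k ^+ 2.
Proof.
have := wallis_le k.*2; rewrite wallis_even.
have k0 : 0 <= k.*2.+1%:R * central R k by rewrite mulr_ge0 ?ler0n ?ltW ?central_gt0.
move=> /(ler_wpM2l k0); rewrite wallis_odd => H.
have : 2 * 1 <= 2 * (k.*2.+1%:R * central R k * (pi / 2 * central R k)) by rewrite ler_pM2l.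
rewrite mulr1; move=> /le_trans; apply; rewrite le_eqVlt; apply/orP; left; apply/eqP.
by field.
Qed.

(** The lower Wallis bound at 2 reads pi >= 128 / 45. *)
Lemma pi_sqr_ge8 : 8 <= pi ^+ 2 :> R.
Proof.
have := central_wallis_ge 2; rewrite (_ : 2.*2.+1 = 5)%N//.
have -> : central R 2 = 3 / 8.
  by rewrite /central /half_rising !big_ord_recr big_ord0/= !factS fact0; field.
move=> H; have : (71 / 25 : R) <= pi by lra.
move=> {}H; apply: (@le_trans _ _ ((71/25)^+2)); first by lra.
by rewrite ler_sqr ?nnegrE ?pi_ge0//; lra.
Qed.

End Wallis.

(** * The Stirling bound *)

Section Stirling.
Variable R : realType.

(** The logarithm of k! e^k / k^(k + 1/2), whose limit is ln (2 pi) / 2. *)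
Definition ln_stirling (k : nat) : R :=
  ln k`!%:R + k%:R - (k%:R + 2^-1) * ln k%:R.

Lemma ln_factS k : ln k.+1`!%:R = ln k.+1%:R + ln k`!%:R :> R.
Proof. by rewrite factS natrM lnM ?posrE ?ltr0n ?fact_gt0. Qed.

(** One step of [k] is the midpoint rule [ln_succ_ge]. *)
Lemma ln_stirling_noninc i j : (0 < i)%N -> (i <= j)%N ->
  ln_stirling j <= ln_stirling i.
Proof.
move=> i0 /subnK <-; elim: (j - i)%N => [//|m IH].
apply: le_trans IH; rewrite /ln_stirling addSn ln_factS.
set k := (m + i)%N.
have k0 : (0 < k)%N by rewrite ltn_addl.
have kR : (0:R) < k%:R + 2^-1 by rewrite ltr_wpDl ?ler0n// invr_gt0 ltr0n.
have := ln_succ_ge R k0; rewrite -(ler_pM2l kR) mulfV ?gt_eqF// -(natr1 k).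
lra.
Qed.

(** One step of [k] is the trapezoid rule [ln_succ_le], whose errors
    1 / (4k (k + 1)) telescope.  Only the existence of a lower bound matters
    for [stirling_ge]. *)
Lemma ln_stirling_ge k : (0 < k)%N -> 3 / 4 <= ln_stirling k.
Proof.
move=> k0; suff : 3 / 4 + (4 * k%:R)^-1 <= ln_stirling k.
  have : (0:R) <= (4 * k%:R)^-1 by rewrite invr_ge0 mulr_ge0.
  lra.
case: k k0 => // + _; elim => [|k IH].
  by rewrite /ln_stirling factS fact0 muln1 ln1; lra.
have := @ln_succ_le R k.+1 isT; rewrite /ln_stirling (ln_factS k.+1).
move: IH; rewrite /ln_stirling -!(natr1 k.+1); set x := k.+1%:R.
have x0 : 0 < x by rewrite ltr0n.
have xh : 0 < x + 2^-1 by lra.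
have x1 : 0 < x + 1 by lra.
move=> IH; rewrite -(ler_pM2l xh).
have -> : (x + 2^-1) * ((x^-1 + (x + 1)^-1) / 2) = 1 + (4 * x)^-1 - (4 * (x + 1))^-1.
  by field; rewrite !gt_eqF.
move: IH; set u := (4 * x)^-1; set v := (4 * (x + 1))^-1.
set a := ln x; set b := ln (x + 1); set c := ln _; rewrite !mulrDl !mulrBr.
lra.
Qed.

(** The identity (1/2)_k = (2k)! / (4^k k!) between the half-integer products
    and the factorials. *)
Lemma half_rising_fact k : half_rising R k * (4 ^ k)%N%:R * k`!%:R = (k.*2)`!%:R.
Proof.
elim: k => [|k IH]; first by rewrite half_rising0 fact0 !mulr1.
rewrite doubleS !factS !natrM -IH half_risingS expnS natrM -!natr1 -mul2n natrM.
by field.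
Qed.

Lemma ln_half_rising k :
  ln (half_rising R k) = ln (k.*2)`!%:R - k.*2%:R * ln 2 - ln k`!%:R.
Proof.
rewrite -half_rising_fact !lnM ?posrE ?mulr_gt0 ?half_rising_gt0 ?ltr0n ?fact_gt0 ?expn_gt0//.
have -> : ln (4 ^ k)%N%:R = k.*2%:R * ln 2 :> R.
  by rewrite (_ : 4 = 2 ^ 2)%N// -expnM mul2n natrX lnXn// mulr_natl.
by ring.
Qed.

(** The factorial of [2k] is that of [k] squared times the central binomial
    coefficient, which [central_wallis_le] bounds. *)
Lemma ln_stirling_double k : (0 < k)%N ->
  ln_stirling k.*2 - 2^-1 * ln (2 * pi) <=
    2 * (ln_stirling k - 2^-1 * ln (2 * pi)).
Proof.
move=> k0; have kR : (0:R) < k%:R by rewrite ltr0n.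
have Ec : ln (central R k) = ln (half_rising R k) - ln k`!%:R.
  by rewrite ln_div ?posrE ?half_rising_gt0 ?ltr0n ?fact_gt0.
move: (central_gt0 R k) (central_wallis_le R k) Ec.
move: (central R k) => c c0.
rewrite -ler_ln ?posrE ?mulr_gt0 ?exprn_gt0 ?pi_gt0//.
rewrite ln1 expr2 !lnM ?posrE ?mulr_gt0 ?pi_gt0// => + Ec; rewrite Ec.
rewrite ln_half_rising /ln_stirling.
rewrite -mul2n natrM lnM ?posrE//; set A := ln _`!%:R; set B := ln _`!%:R.
rewrite -mulr_natr.
lra.
Qed.

(** If the excess over ln (2 pi) / 2 were negative somewhere, it would tend to
    minus infinity along the doublings of [k], against [ln_stirling_ge]. *)
Lemma stirling_ge k : (0 < k)%N -> 2^-1 * ln (2 * pi) <= ln_stirling k.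
Proof.
move=> k0; rewrite leNgt; apply/negP => H.
set y := fun k => ln_stirling k - 2^-1 * ln (2 * pi) : R.
have y0 : y k < 0 by rewrite /y; lra.
have yr r : y (2 ^ r * k)%N <= (2 ^ r)%N%:R * y k.
  elim: r => [|r IH]; first by rewrite expn0 mul1r mul1n.
  have kr : (0 < 2 ^ r * k)%N by rewrite muln_gt0 expn_gt0.
  have := ln_stirling_double kr; rewrite -!/(y _) -mul2n mulnA -expnS.
  move=> /le_trans; apply; rewrite expnS natrM -mulrA ler_pM2l//.
pose D : R := 2^-1 * ln (2 * pi).
have D0 : 0 <= D.
  by rewrite mulr_ge0 ?invr_ge0// ln_ge0//; have := pi_ge2 R; lra.
have Dy : 0 <= D / - y k by rewrite divr_ge0 ?oppr_ge0 ?(ltW y0).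
have [r Hr] : exists r : nat, D / - y k < r%:R.
  by exists (Num.bound (D / - y k)); exact: archi_boundP.
have kr : (0 < 2 ^ r * k)%N by rewrite muln_gt0 expn_gt0.
have := yr r; have := ln_stirling_ge kr; rewrite /y -/D -/(y k) => H1 H2.
have rr : r%:R <= (2 ^ r)%N%:R :> R by rewrite ler_nat ltnW// ltn_expl.
move: Hr; rewrite ltr_pdivrMr ?oppr_gt0// mulrN => Hr.
have Hy : (2 ^ r)%N%:R * y k <= r%:R * y k by rewrite ler_wnM2r// ltW.
have aux (a b c d : R) : 3 / 4 <= c -> c - d <= a -> d < - b -> a <= b -> False.
  by lra.
exact: aux H1 H2 Hr Hy.
Qed.

End Stirling.

(** * Krichevsky-Trofimov probabilities *)

Section KT.
Variable R : realType.

(** The probability of a given sequence of [j] heads and [l] tails when the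
    bias of the coin follows the arcsine law. *)
Definition kt (j l : nat) : R :=
  half_rising R j * half_rising R l / (j + l)`!%:R.

Lemma kt_gt0 j l : 0 < kt j l.
Proof. by rewrite divr_gt0 ?mulr_gt0 ?half_rising_gt0 ?ltr0n ?fact_gt0. Qed.

Lemma kt00 : kt 0 0 = 1.
Proof. by rewrite /kt half_rising0 fact0 mulr1 divr1. Qed.

Lemma ktSl j l : kt j.+1 l = kt j l * ((j%:R + 2^-1) / (j + l).+1%:R).
Proof.
rewrite /kt addSn factS natrM half_risingS.
have := fact_neq0 R (j + l); have : (j + l).+1%:R != 0 :> R by rewrite pnatr_eq0.
by move=> *; field; apply/andP.
Qed.

Lemma ktC j l : kt j l = kt l j.
Proof. by rewrite /kt addnC [X in X / _]mulrC. Qed.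

Lemma ktSr j l : kt j l.+1 = kt j l * ((l%:R + 2^-1) / (j + l).+1%:R).
Proof. by rewrite ktC ktSl ktC addnC. Qed.

Lemma kt_split j l : kt j l = kt j.+1 l + kt j l.+1.
Proof.
rewrite ktSl ktSr -(natr1 (j + l)) natrD; field.
by rewrite gt_eqF// ltr_wpDl// addr_ge0 ?ler0n.
Qed.

(** By [half_rising_fact] the Stirling factors at [2j] and [j] are to be
    compared, and they decrease. *)
Lemma ln_half_rising_le j :
  ln (half_rising R j) <= j%:R * ln j%:R - j%:R + 2^-1 * ln 2.
Proof.
case: j => [|j].
  by rewrite half_rising0 ln1 mul0r subr0 add0r mulr_ge0 ?invr_ge0// ln_ge0// ler1n.
set k := j.+1; have k0 : (0 < k)%N by [].
have kk : (k <= k.*2)%N by rewrite -addnn leq_addr.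
have := ln_stirling_noninc R k0 kk; rewrite ln_half_rising /ln_stirling.
rewrite -mul2n natrM lnM ?posrE ?ltr0n//.
lra.
Qed.

(** The upper bounds of [ln_half_rising_le] on the numerator of [kt] and the
    Stirling lower bound on its denominator go in the same direction, hence
    there is no error term. *)
Lemma kt_ln_ge j k : (0 < k)%N -> (j <= k)%N ->
  2^-1 * ln (pi * k%:R / 2) + k%:R * bin_entropy (j%:R / k%:R) <=
    - ln (kt j (k - j)).
Proof.
move=> k0 jk; rewrite bin_entropy_frac//.
have kR : (0:R) < k%:R by rewrite ltr0n.
have -> : ln (kt j (k - j)) =
    ln (half_rising R j) + ln (half_rising R (k - j)) - ln k`!%:R.
  by rewrite /kt subnKC// ln_div ?lnM ?posrE ?mulr_gt0 ?half_rising_gt0 ?ltr0n ?fact_gt0.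
have -> : ln (pi * k%:R / 2) = ln pi + ln k%:R - ln 2 :> R.
  by rewrite ln_div ?lnM ?posrE ?mulr_gt0 ?pi_gt0.
have := ln_half_rising_le j; have := ln_half_rising_le (k - j).
have := stirling_ge R k0; rewrite /ln_stirling lnM ?posrE ?pi_gt0//.
rewrite (natrB _ jk).
move: (ln (half_rising R (k - j))) (ln (half_rising R j)) => A B.
lra.
Qed.

(** The entropy of [k] tosses, in nats. *)
Definition kt_codelength (k : nat) : R :=
  arcsine_mean k (fun j => - ln (kt j (k - j))).

Lemma kt_codelength_ge k : (0 < k)%N ->
  2^-1 * ln (pi * k%:R / 2) + k%:R * mean_entropy R k <= kt_codelength k.
Proof.
move=> k0; rewrite /mean_entropy -arcsine_meanZ.
rewrite -[X in X + _](arcsine_mean_cst k) -arcsine_meanD.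
by apply: arcsine_mean_le => j jk; exact: kt_ln_ge.
Qed.

(** The information that [k] tosses give about a bias drawn from the discrete
    law of index [K]; the second term on the left is the price of the
    discretization. *)
Lemma kt_redundancy_ge k K : (0 < k)%N -> (k <= K)%N ->
  2^-1 * ln (pi * k%:R / (2 * expR 1)) - k%:R / (2 * K%:R) <=
    kt_codelength k - k%:R * mean_entropy R K.
Proof.
move=> k0 kK; have K0 := leq_trans k0 kK.
have kP : (0:R) < k%:R by rewrite ltr0n.
have KP : (0:R) < K%:R by rewrite ltr0n.
have := kt_codelength_ge k0.
have := mean_entropy_gap R k0 kK; rewrite -(ler_pM2l kP) !mulrDr.
rewrite (_ : k%:R * (2 * k%:R)^-1 = 2^-1); last by field; rewrite gt_eqF.
have -> : ln (pi * k%:R / (2 * expR 1)) = ln (pi * k%:R / 2) - 1 :> R.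
  have e0 : (0 : R) < expR 1 by exact: expR_gt0.
  have x0 : 0 < pi * k%:R / 2 :> R by rewrite divr_gt0 ?mulr_gt0 ?pi_gt0.
  by rewrite invfM mulrA (ln_div x0 e0) expRK.
lra.
Qed.

Lemma arcsine_mean_urn2 k (F : nat -> nat -> R) :
  arcsine_mean k.+1 (fun j => F j (k.+1 - j)%N) = arcsine_mean k (fun j =>
    ((j%:R + 2^-1) * F j.+1 (k - j)%N + ((k - j)%:R + 2^-1) * F j (k - j).+1)
      / k.+1%:R).
Proof.
by rewrite arcsine_mean_urn; apply: arcsine_mean_ext => j jk; rewrite subSS subSn.
Qed.

(** The Pochhammer symbol (j + 1/2)_a: up to a factor depending on time only,
    it is a martingale of the urn. *)
Definition shifted_rising (a j : nat) : R := \prod_(t < a) (j%:R + t%:R + 2^-1).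

Lemma shifted_risingS a j :
  shifted_rising a.+1 j = shifted_rising a j * (j%:R + a%:R + 2^-1).
Proof. by rewrite /shifted_rising big_ord_recr. Qed.

Lemma shifted_rising_shift a j :
  (j%:R + 2^-1) * shifted_rising a j.+1 = shifted_rising a j * (j%:R + a%:R + 2^-1).
Proof.
rewrite -shifted_risingS /shifted_rising big_ord_recl addr0; congr (_ * _).
by apply: eq_bigr => t _; rewrite lift0 -(natr1 j) -(natr1 t); ring.
Qed.

Lemma rising_shift a K :
  K.+1%:R * \prod_(t < a) (K.+1%:R + t.+1%:R) =
  \prod_(t < a) (K%:R + t.+1%:R) * (K%:R + a.+1%:R) :> R.
Proof.
have <- : \prod_(t < a.+1) (K%:R + t.+1%:R) =
   \prod_(t < a) (K%:R + t.+1%:R) * (K%:R + a.+1%:R) :> R by rewrite big_ord_recr.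
rewrite big_ord_recl natr1; congr (_ * _).
by apply: eq_bigr => t _; rewrite lift0 -(natr1 K) -(natr1 t.+1); ring.
Qed.

Lemma arcsine_mean_shifted_rising a K :
  arcsine_mean K (shifted_rising a) =
  kt a 0 * \prod_(t < a) (K%:R + t.+1%:R).
Proof.
elim: K => [|K IH].
  rewrite /arcsine_mean big_ord1 /arcsine_weight subnn central0 !mul1r.
  have -> : \prod_(t < a) (0 + t.+1%:R) = a`!%:R :> R.
    elim: a => [|a IH]; first by rewrite big_ord0 fact0.
    by rewrite big_ord_recr/= IH add0r factS natrM mulrC.
  rewrite /kt half_rising0 mulr1 addn0 divfK ?fact_neq0//.
  by apply: eq_bigr => t _; rewrite add0r.
have K1 : K.+1%:R != 0 :> R by rewrite pnatr_eq0.
apply: (mulfI K1); rewrite mulrCA rising_shift mulrA -IH arcsine_mean_urn.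
rewrite -arcsine_meanZ [RHS]mulrC -arcsine_meanZ.
apply: arcsine_mean_ext => j jK.
rewrite mulrC divfK// shifted_rising_shift natrB// -[a.+1%:R]natr1.
by field.
Qed.

Definition grid (K i : nat) : R := i%:R / K.+1%:R.

Lemma rising_ratio_cvg a :
  (fun K => \prod_(t < a) (K.+1%:R + t.+1%:R) / K.+1%:R ^+ a) @ \oo --> (1 : R).
Proof.
elim: a => [|a IH].
  have -> : (fun K => \prod_(t < 0) (K.+1%:R + t.+1%:R) / K.+1%:R ^+ 0) = (fun=> 1 : R).
    by apply/funext => K; rewrite big_ord0 expr0 divr1.
  exact: cvg_cst.
have -> : (fun K => \prod_(t < a.+1) (K.+1%:R + t.+1%:R) / K.+1%:R ^+ a.+1) =
  (fun K => \prod_(t < a) (K.+1%:R + t.+1%:R) / K.+1%:R ^+ a * (1 + a.+1%:R * harmonic K)) :> (nat -> R).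
  apply/funext => K; rewrite big_ord_recr/= exprS /harmonic/=.
  have K1 : K.+1%:R != 0 :> R by rewrite pnatr_eq0.
  have Ka : K.+1%:R ^+ a != 0 :> R by rewrite expf_neq0.
  by field; apply/andP.
rewrite -[X in _ --> X]mulr1; apply: cvgM => //.
rewrite -[X in _ --> X]addr0; apply: cvgD; first exact: cvg_cst.
rewrite -[X in _ --> X](mulr0 a.+1%:R); apply: cvgMr; exact: cvg_harmonic.
Qed.

Lemma shifted_moment_cvg j a :
  (fun K => arcsine_mean K.+1 (fun i => grid K i ^+ j * shifted_rising a i)
     / K.+1%:R ^+ a) @ \oo --> kt (j + a) 0.
Proof.
elim: j a => [|j IH] a.
  have -> : (fun K => arcsine_mean K.+1 (fun i => grid K i ^+ 0 * shifted_rising a i)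
     / K.+1%:R ^+ a) =
     (fun K => kt a 0 * (\prod_(t < a) (K.+1%:R + t.+1%:R) / K.+1%:R ^+ a)).
    apply/funext => K; rewrite mulrA -arcsine_mean_shifted_rising; congr (_ / _).
    by apply: arcsine_mean_ext => i _; rewrite expr0 mul1r.
  rewrite -[X in _ --> X]mulr1; apply: cvgMr; exact: rising_ratio_cvg.
have -> : (fun K => arcsine_mean K.+1 (fun i => grid K i ^+ j.+1 * shifted_rising a i)
     / K.+1%:R ^+ a) = (fun K =>
     arcsine_mean K.+1 (fun i => grid K i ^+ j * shifted_rising a.+1 i) / K.+1%:R ^+ a.+1
     - ((a%:R + 2^-1) * harmonic K) *
     (arcsine_mean K.+1 (fun i => grid K i ^+ j * shifted_rising a i) / K.+1%:R ^+ a)).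
  apply/funext => K; rewrite /harmonic/=.
  have K1 : K.+1%:R != 0 :> R by rewrite pnatr_eq0.
  have Ka : K.+1%:R ^+ a != 0 :> R by rewrite expf_neq0.
  have -> : arcsine_mean K.+1 (fun i => grid K i ^+ j * shifted_rising a.+1 i) =
    arcsine_mean K.+1 (fun i => K.+1%:R * (grid K i ^+ j.+1 * shifted_rising a i)
      + (a%:R + 2^-1) * (grid K i ^+ j * shifted_rising a i)).
    apply: arcsine_mean_ext => i _; rewrite shifted_risingS exprS.
    have -> : (i%:R : R) = K.+1%:R * grid K i by rewrite /grid mulrC divfK.
    ring.
  rewrite arcsine_meanD !arcsine_meanZ exprS; field.
  by apply/andP.
rewrite addSnnS -[X in _ --> X]subr0; apply: cvgB; first exact: IH.
rewrite -[X in _ --> X](mul0r (kt (j + a) 0)); apply: cvgM => //.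
rewrite -[X in _ --> X](mulr0 (a%:R + 2^-1)); apply: cvgMr; exact: cvg_harmonic.
Qed.

(** The number of heads divided by the number of tosses converges in law to
    the bias, and the moments of the arcsine law are the values of [kt]. *)
Lemma moment_cvg j l :
  (fun K => arcsine_mean K.+1 (fun i => grid K i ^+ j * (1 - grid K i) ^+ l))
    @ \oo --> kt j l.
Proof.
elim: l j => [|l IH] j.
  have -> : (fun K => arcsine_mean K.+1 (fun i => grid K i ^+ j * (1 - grid K i) ^+ 0)) =
    (fun K => arcsine_mean K.+1 (fun i => grid K i ^+ j * shifted_rising 0 i)
      / K.+1%:R ^+ 0).
    apply/funext => K; rewrite expr0 divr1; apply: arcsine_mean_ext => i _.
    by rewrite /shifted_rising big_ord0 expr0.
  by have := @shifted_moment_cvg j 0; rewrite addn0; apply.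
have -> : (fun K => arcsine_mean K.+1 (fun i => grid K i ^+ j * (1 - grid K i) ^+ l.+1)) =
 (fun K => arcsine_mean K.+1 (fun i => grid K i ^+ j * (1 - grid K i) ^+ l) -
   arcsine_mean K.+1 (fun i => grid K i ^+ j.+1 * (1 - grid K i) ^+ l)).
  apply/funext => K; apply/eqP; rewrite eq_sym subr_eq -arcsine_meanD; apply/eqP.
  by apply: arcsine_mean_ext => i _; rewrite !exprS; ring.
have -> : kt j l.+1 = kt j l - kt j.+1 l by rewrite (kt_split j l) addrC addKr.
by apply: cvgB.
Qed.

End KT.

(** * Binomial means *)

Section Binomial.
Variable R : realType.
Variable m : R.
Implicit Types phi : nat -> R.

(** The mean of [phi] under the binomial law of parameters [n] and [m], with
    one trial peeled off at each step; this recursion is the one that the urn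
    law obeys in [urn_marginal]. *)
Fixpoint bin_mean (n : nat) phi : R :=
  if n is n'.+1 then bin_mean n' (fun k => (1 - m) * phi k + m * phi k.+1)
  else phi 0%N.

Lemma bin_mean_ext n phi1 phi2 : phi1 =1 phi2 -> bin_mean n phi1 = bin_mean n phi2.
Proof. by move=> /funext ->. Qed.

Lemma bin_mean_le n phi1 phi2 : 0 <= m <= 1 ->
  (forall k, (k <= n)%N -> phi1 k <= phi2 k) -> bin_mean n phi1 <= bin_mean n phi2.
Proof.
move=> /andP[m0 m1]; elim: n phi1 phi2 => [|n IH] phi1 phi2 H /=; first exact: H.
apply: IH => k kn; apply: lerD; rewrite ler_wpM2l ?subr_ge0// H//.
exact: leqW.
Qed.

Lemma bin_meanD n phi1 phi2 :
  bin_mean n (fun k => phi1 k + phi2 k) = bin_mean n phi1 + bin_mean n phi2.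
Proof.
elim: n phi1 phi2 => [//|n IH] phi1 phi2 /=; rewrite -IH.
by apply: bin_mean_ext => k; ring.
Qed.

Lemma bin_meanZ n c phi : bin_mean n (fun k => c * phi k) = c * bin_mean n phi.
Proof.
elim: n phi => [//|n IH] phi /=; rewrite -IH.
by apply: bin_mean_ext => k; ring.
Qed.

Lemma bin_mean_cst n c : bin_mean n (fun=> c) = c.
Proof.
by elim: n => [//|n IH] /=; rewrite -[RHS]IH; apply: bin_mean_ext => k; ring.
Qed.

Lemma bin_mean_id n : bin_mean n (fun k => k%:R) = n%:R * m.
Proof.
elim: n => [|n IH] /=; first by rewrite mul0r.
rewrite -natr1 mulrDl mul1r -IH -[X in _ = _ + X](bin_mean_cst n) -bin_meanD.
by apply: bin_mean_ext => k; rewrite -natr1; ring.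
Qed.

Lemma bin_mean_sqr n c : bin_mean n (fun k => (k%:R - c) ^+ 2) =
  n%:R * (m * (1 - m)) + (n%:R * m - c) ^+ 2.
Proof.
elim: n c => [|n IH] c /=; first by ring.
transitivity (bin_mean n (fun k => (k%:R - (c - m)) ^+ 2 + m * (1 - m))).
  by apply: bin_mean_ext => k; rewrite -natr1; ring.
by rewrite bin_meanD IH bin_mean_cst -natr1; ring.
Qed.

(** Let [mu] be the mean, [t = lam * mu] and [s = lam^-1].  The quadratic
    function [1 - ((k - mu - s) / (t + s)) ^+ 2] is at most 1, and at most 0
    for [k <= mu - t]; so [phi] dominates its product by [L].  The variance
    being at most [mu], this choice of [s] gives the stated mean. *)
Lemma bin_mean_cantelli n (lam L : R) phi : 0 < m <= 1 -> (0 < n)%N -> 0 < lam ->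
  0 <= L -> (forall k, (k <= n)%N -> 0 <= phi k) ->
  (forall k, (k <= n)%N -> n%:R * m * (1 - lam) < k%:R -> L <= phi k) ->
  L / (1 + (lam ^+ 2 * (n%:R * m))^-1) <= bin_mean n phi.
Proof.
move=> /andP[m0 m1] n0 l0 L0 phi0 phiL.
have nR : (0 : R) < n%:R by rewrite ltr0n.
set mu := n%:R * m; have mu0 : 0 < mu by rewrite mulr_gt0.
pose s := lam^-1; pose t := lam * mu.
have s0 : 0 < s by rewrite invr_gt0.
have t0 : 0 < t by rewrite mulr_gt0.
have ts0 : 0 < (t + s) ^+ 2 by rewrite exprn_gt0// addr_gt0.
have LT : 0 <= L / (t + s) ^+ 2 by rewrite divr_ge0// ltW.
pose psi (k : nat) : R := L + (- (L / (t + s) ^+ 2)) * (k%:R - (mu + s)) ^+ 2.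
apply: (@le_trans _ _ (bin_mean n psi)); last first.
  apply: bin_mean_le => [|k kn]; first by rewrite (ltW m0).
  have [kL|kU] := lerP k%:R (mu * (1 - lam)).
    apply: le_trans (phi0 _ kn); rewrite /psi mulNr subr_le0.
    rewrite mulrAC ler_pdivlMr// ler_wpM2l//.
    have -> : (k%:R - (mu + s)) ^+ 2 = (mu + s - k%:R) ^+ 2 by ring.
    have H : t + s <= mu + s - k%:R by rewrite /t; lra.
    have ts : 0 <= t + s by rewrite addr_ge0 ?ltW.
    by rewrite ler_sqr ?nnegrE// (le_trans ts).
  apply: le_trans (phiL _ kn kU); rewrite /psi gerDl mulNr oppr_le0.
  by rewrite mulr_ge0 ?sqr_ge0.
rewrite /psi bin_meanD bin_meanZ bin_mean_cst bin_mean_sqr -/mu.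
have -> : mu - (mu + s) = - s by ring.
have -> : L / (1 + (lam ^+ 2 * mu)^-1) =
    L + - (L / (t + s) ^+ 2) * (mu + (- s) ^+ 2).
  rewrite /t /s; field; rewrite !gt_eqF//= ?addr_gt0 ?mulr_gt0 ?exprn_gt0//.
rewrite lerD2l ler_wnM2l ?oppr_le0// lerD2r.
by rewrite mulrA ler_piMr ?(ltW mu0)//; lra.
Qed.

End Binomial.

(** * Words over a finite alphabet *)

Section Words.
Variables (R : realType) (A : finType).
Implicit Types (F : seq A -> R) (P g : A -> R).

Definition word_sum (n : nat) F : R := \sum_(x : n.-tuple A) F x.

Lemma word_sum0 F : word_sum 0 F = F [::].
Proof.
rewrite /word_sum (big_pred1 [tuple]) // => x; apply/esym/eqP.
exact: tuple0.
Qed.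

Lemma word_sumS n F : word_sum n.+1 F = \sum_a word_sum n (fun x => F (a :: x)).
Proof.
rewrite /word_sum pair_big/=.
rewrite (reindex (fun ax : A * n.-tuple A => [tuple of ax.1 :: ax.2]))//=.
exists (fun x : n.+1.-tuple A => (thead x, [tuple of behead x])) => /=.
  by case=> a x _ /=; rewrite theadE; congr pair; apply: val_inj.
by move=> x _; rewrite [x in RHS]tuple_eta.
Qed.

Lemma word_sum_ext n F1 F2 : F1 =1 F2 -> word_sum n F1 = word_sum n F2.
Proof. by move=> /funext ->. Qed.

Lemma word_sumD n F1 F2 :
  word_sum n (fun x => F1 x + F2 x) = word_sum n F1 + word_sum n F2.
Proof. exact: big_split. Qed.

Lemma word_sumZ n c F : word_sum n (fun x => c * F x) = c * word_sum n F.
Proof. by rewrite /word_sum mulr_sumr. Qed.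

Lemma word_sum_sum n (I : finType) (F : I -> seq A -> R) :
  word_sum n (fun x => \sum_i F i x) = \sum_i word_sum n (F i).
Proof. exact: exchange_big. Qed.

Definition iid_law P (x : seq A) : R := \prod_(a <- x) P a.

Lemma iid_law_cons P a x : iid_law P (a :: x) = P a * iid_law P x.
Proof. exact: big_cons. Qed.

Lemma iid_law_sum1 P n : \sum_a P a = 1 -> word_sum n (iid_law P) = 1.
Proof.
move=> P1; elim: n => [|n IH]; first by rewrite word_sum0 /iid_law big_nil.
rewrite word_sumS -P1; apply: eq_bigr => a _.
under word_sum_ext do rewrite iid_law_cons.
by rewrite word_sumZ IH mulr1.
Qed.

Lemma iid_law_add P g n : \sum_a P a = 1 ->
  word_sum n (fun x => iid_law P x * \sum_(a <- x) g a) =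
  n%:R * \sum_a P a * g a.
Proof.
move=> P1; elim: n => [|n IH]; first by rewrite word_sum0 big_nil mulr0 mul0r.
rewrite word_sumS -natr1 mulrDl mul1r.
transitivity (\sum_a (P a * g a + P a * (n%:R * \sum_b P b * g b))).
  apply: eq_bigr => a _; rewrite -IH.
  transitivity (word_sum n (fun x => P a * g a * iid_law P x +
     P a * (iid_law P x * \sum_(b <- x) g b))).
    by apply: word_sum_ext => x; rewrite iid_law_cons big_cons; ring.
  by rewrite word_sumD !word_sumZ iid_law_sum1// mulr1.
by rewrite big_split/= -mulr_suml P1 mul1r addrC.
Qed.

Lemma prod_count g (x : seq A) :
  \prod_(a <- x) g a = \prod_a g a ^+ count_mem a x.
Proof.
elim: x => [|b x IH].
  by rewrite big_nil big1// => a _.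
rewrite big_cons IH (bigD1 b)//= [RHS](bigD1 b)//= eqxx exprD expr1 mulrA.
congr (_ * _); apply: eq_bigr => a ab.
by rewrite eq_sym (negbTE ab) add0n.
Qed.

(** If some letter of the word has probability 0, both sides vanish. *)
Lemma iid_law_ln P (x : seq A) : (forall a, 0 <= P a) ->
  iid_law P x * ln (iid_law P x) = iid_law P x * \sum_(a <- x) ln (P a).
Proof.
move=> P0; elim: x => [|a x IH]; first by rewrite /iid_law !big_nil ln1.
rewrite iid_law_cons big_cons; have [->|Pa] := eqVneq (P a) 0.
  by rewrite !mul0r.
have [Px|Px] := eqVneq (iid_law P x) 0; first by rewrite Px mulr0 !mul0r.
rewrite lnM ?posrE ?lt0r ?Pa ?P0 ?Px ?prodr_ge0// -!mulrA !mulrDr IH.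
ring.
Qed.

Definition bayes_mixture (Th : finType) (W : Th -> R) (Q : Th -> A -> R)
    (x : seq A) : R :=
  \sum_th W th * iid_law (Q th) x.

(** The mutual information, in nats, between the parameter and a word of
    length [n]: the entropy of the mixture minus the mean entropy. *)
Definition bayes_information (Th : finType) (W : Th -> R) (Q : Th -> A -> R)
    (n : nat) : R :=
  \sum_th W th * word_sum n (fun x => iid_law (Q th) x * ln (iid_law (Q th) x))
  - word_sum n (fun x => bayes_mixture W Q x * ln (bayes_mixture W Q x)).

End Words.

(** * Mixtures of laws on pairs of letters *)

Section Pairs.
Variables (R : realType) (p : nat) (m : 'I_p -> R).
Hypothesis m_gt0 : forall i, 0 < m i.
Hypothesis m_sum1 : \sum_i m i = 1.

Local Notation letter := ('I_p * bool)%type.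
Implicit Types (x : seq letter) (F : nat -> nat -> R).

Definition cnt (i : 'I_p) (b : bool) x : nat := count_mem (i, b) x.

Arguments cnt : simpl never.
Arguments kt : simpl never.

Lemma sum_letters (G : letter -> R) :
  \sum_a G a = \sum_i (G (i, true) + G (i, false)).
Proof.
rewrite (eq_bigr (fun a => G (a.1, a.2))); last by case.
rewrite -(pair_bigA _ (fun i b => G (i, b)))/=.
by apply: eq_bigr => i _; rewrite big_bool.
Qed.

(** A letter [(i, b)] is the outcome [b] of a toss of the coin [i].  In the laws
    of this form the coins are chosen independently according to [m], and
    [kappa i j l] is the probability of a given sequence of [j] heads and [l]
    tails of the coin [i]. *)
Definition pair_law (kappa : 'I_p -> nat -> nat -> R) x : R :=
  \prod_i (m i ^+ (cnt i true x + cnt i false x) *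
           kappa i (cnt i true x) (cnt i false x)).

Definition urn_law x : R := pair_law (fun _ => kt R) x.

Lemma mass_le1 i : m i <= 1.
Proof.
rewrite -m_sum1 (bigD1 i)//= lerDl sumr_ge0// => j _; exact: ltW.
Qed.

Lemma urn_law_gt0 x : 0 < urn_law x.
Proof. by apply: prodr_gt0 => i _; rewrite mulr_gt0 ?exprn_gt0 ?kt_gt0. Qed.

Lemma cnt_cons_eq i b x : cnt i b ((i, b) :: x) = (cnt i b x).+1.
Proof. by rewrite /cnt /= eqxx. Qed.

Lemma cnt_cons_neq i b a x : a != (i, b) -> cnt i b (a :: x) = cnt i b x.
Proof. by rewrite /cnt /= => /negbTE ->. Qed.

(** One urn for each coin: the next letter is predicted by choosing the coin
    and then drawing from its urn. *)
Lemma urn_law_cons i b x : urn_law ((i, b) :: x) = urn_law x * (m i *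
  (((cnt i b x)%:R + 2^-1) / (cnt i true x + cnt i false x).+1%:R)).
Proof.
rewrite /urn_law /pair_law (bigD1 i)//= [in RHS](bigD1 i)//=.
under eq_bigr => j ji.
  rewrite !cnt_cons_neq; last 2 first.
  - by apply: contraNneq ji => -[->].
  - by apply: contraNneq ji => -[->].
  over.
set T := \prod_(_ < _ | _) _.
case: b; rewrite cnt_cons_eq cnt_cons_neq ?xpair_eqE ?andbF//=.
  by rewrite addSn exprS ktSl; ring.
by rewrite addnS exprS ktSr; ring.
Qed.

(** The letters of the other pairs are integrated out: the number of tosses of
    the coin [i] is binomial, and given this number its heads follow the
    discrete arcsine law. *)
Lemma urn_marginal n i F :
  word_sum n (fun x => urn_law x * F (cnt i true x) (cnt i false x)) =
  bin_mean (m i) n (fun k => arcsine_mean k (fun j => F j (k - j)%N)).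
Proof.
elim: n F => [|n IH] F.
  rewrite word_sum0 /urn_law /pair_law big1 ?mul1r//=.
    rewrite /arcsine_mean big_ord1 /arcsine_weight subnn central0 !mul1r.
    by [].
  by move=> j _; rewrite expr0 kt00 mulr1.
rewrite word_sumS -word_sum_sum.
pose F' j l := (1 - m i) * F j l + m i *
  (((j%:R + 2^-1) * F j.+1 l + (l%:R + 2^-1) * F j l.+1) / (j + l).+1%:R).
transitivity (word_sum n (fun x => urn_law x * F' (cnt i true x) (cnt i false x))).
  apply: word_sum_ext => x.
  rewrite sum_letters (bigD1 i)//=.
  have -> : \sum_(j < p | j != i)
      (urn_law ((j, true) :: x) *
         F (cnt i true ((j, true) :: x)) (cnt i false ((j, true) :: x)) +
       urn_law ((j, false) :: x) *
         F (cnt i true ((j, false) :: x)) (cnt i false ((j, false) :: x))) =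
      \sum_(j < p | j != i) m j *
        (urn_law x * F (cnt i true x) (cnt i false x)).
    apply: eq_bigr => j ji; rewrite !urn_law_cons.
    rewrite !cnt_cons_neq; try by rewrite xpair_eqE (negbTE ji).
    rewrite -!natr1 natrD; field.
    by rewrite gt_eqF// ltr_wpDl// addr_ge0 ?ler0n.
  rewrite -mulr_suml.
  have -> : \sum_(j < p | j != i) m j = 1 - m i.
    by apply/eqP; rewrite eq_sym subr_eq -m_sum1 (bigD1 i)//= addrC.
  rewrite !urn_law_cons !cnt_cons_eq.
  rewrite (cnt_cons_neq (b := false) (a := (i, true)))//; last by rewrite xpair_eqE andbF.
  rewrite (cnt_cons_neq (b := true) (a := (i, false)))//; last by rewrite xpair_eqE andbF.
  by rewrite /F'; ring.
rewrite IH /=; apply: bin_mean_ext => k.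
rewrite arcsine_mean_urn2 -!arcsine_meanZ -arcsine_meanD.
by apply: arcsine_mean_ext => j jk; rewrite /F' subnKC//.
Qed.

Section Prior.
Variable K : nat.
Implicit Types th : {ffun 'I_p -> 'I_K.+2}.

(** The biases of the [p] coins are independent, each of the form [t / K.+1]
    with [t] following the discrete arcsine law of index [K.+1]. *)
Definition prior_weight th : R := \prod_i arcsine_weight R K.+1 (th i).

Definition letter_law th (a : letter) : R :=
  m a.1 * (if a.2 then grid R K (th a.1) else 1 - grid R K (th a.1)).

Definition mixture x : R := bayes_mixture prior_weight letter_law x.

Lemma prior_weight_gt0 th : 0 < prior_weight th.
Proof. by apply: prodr_gt0 => i _; rewrite mulr_gt0 ?central_gt0. Qed.

Lemma prior_mean_prod (g : 'I_p -> nat -> R) :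
  \sum_th prior_weight th * \prod_i g i (th i) = \prod_i arcsine_mean K.+1 (g i).
Proof.
rewrite bigA_distr_bigA; apply: eq_bigr => th _.
by rewrite -big_split.
Qed.

Lemma prior_weight_sum1 : \sum_th prior_weight th = 1.
Proof.
transitivity (\sum_th prior_weight th * \prod_(i < p) 1).
  by apply: eq_bigr => th _; rewrite big1// mulr1.
by rewrite (prior_mean_prod (fun _ _ => 1)) big1// => i _; rewrite arcsine_mean1.
Qed.

Lemma prior_mean_marginal i (g : nat -> R) :
  \sum_th prior_weight th * g (th i) = arcsine_mean K.+1 g.
Proof.
transitivity (\sum_th prior_weight th *
    \prod_j (if j == i then g (th j) else 1)).
  apply: eq_bigr => th _; congr (_ * _).
  by rewrite -big_mkcond big_pred1_eq.
rewrite (prior_mean_prod (fun j t => if j == i then g t else 1)).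
rewrite (bigD1 i)//= eqxx big1 ?mulr1// => j ji.
by rewrite (negbTE ji) arcsine_mean1.
Qed.

Lemma grid_itv (t : 'I_K.+2) : 0 <= grid R K t <= 1.
Proof.
rewrite /grid divr_ge0 ?ler0n//= ler_pdivrMr ?ltr0n// mul1r ler_nat.
by rewrite -ltnS.
Qed.

Lemma letter_law_ge0 th a : 0 <= letter_law th a.
Proof.
rewrite mulr_ge0 ?(ltW (m_gt0 _))//.
by have /andP[] := grid_itv (th a.1); case: ifP => _; rewrite ?subr_ge0.
Qed.

Lemma letter_law_le th a : letter_law th a <= m a.1.
Proof.
rewrite ler_piMr ?(ltW (m_gt0 _))//.
by have /andP[] := grid_itv (th a.1); case: ifP => _ //; rewrite gerBl.
Qed.

Lemma letter_law_sum1 th : \sum_a letter_law th a = 1.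
Proof.
rewrite sum_letters -m_sum1; apply: eq_bigr => i _.
by rewrite /letter_law /=; ring.
Qed.

Lemma iid_letter_law th x : iid_law (letter_law th) x = pair_law
  (fun i j l => grid R K (th i) ^+ j * (1 - grid R K (th i)) ^+ l) x.
Proof.
rewrite /iid_law prod_count.
rewrite (eq_bigr (fun a => letter_law th (a.1, a.2) ^+ cnt a.1 a.2 x)); last by case.
rewrite -(pair_bigA _ (fun i b => letter_law th (i, b) ^+ cnt i b x))/=.
apply: eq_bigr => i _; rewrite big_bool /letter_law /= !exprMn exprD; ring.
Qed.

Lemma mixtureE x : mixture x = pair_law (fun _ j l =>
  arcsine_mean K.+1 (fun t => grid R K t ^+ j * (1 - grid R K t) ^+ l)) x.
Proof.
transitivity (\sum_th prior_weight th *
    \prod_i (m i ^+ (cnt i true x + cnt i false x) *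
      (grid R K (th i) ^+ cnt i true x * (1 - grid R K (th i)) ^+ cnt i false x))).
  by apply: eq_bigr => th _; rewrite iid_letter_law.
rewrite (prior_mean_prod (fun i t => m i ^+ (cnt i true x + cnt i false x) *
  (grid R K t ^+ cnt i true x * (1 - grid R K t) ^+ cnt i false x))).
by apply: eq_bigr => i _; rewrite arcsine_meanZ.
Qed.

Lemma letter_entropy th : \sum_a letter_law th a * ln (letter_law th a) =
  \sum_i m i * (ln (m i) - bin_entropy (grid R K (th i))).
Proof.
rewrite sum_letters; apply: eq_bigr => i _; rewrite /letter_law /bin_entropy/=.
have /andP[] := grid_itv (th i); set v := grid _ _ _ => v0 v1.
have aux (w : R) : 0 <= w -> m i * w * ln (m i * w) =
    m i * w * ln (m i) + m i * (w * ln w).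
  rewrite le_eqVlt => /predU1P[<-|w0]; first by rewrite !(mulr0, mul0r) addr0.
  by rewrite lnM ?posrE//; ring.
by rewrite !aux ?subr_ge0//; ring.
Qed.

(** By independence of the letters only the mean entropy of one letter counts,
    and the biases enter it one at a time; this is how [mean_entropy] arises. *)
Lemma prior_mean_entropy n :
  \sum_th prior_weight th * word_sum n (fun x =>
    iid_law (letter_law th) x * ln (iid_law (letter_law th) x)) =
  n%:R * (\sum_i m i * ln (m i) - mean_entropy R K.+1).
Proof.
transitivity (\sum_th prior_weight th * (n%:R *
    \sum_i m i * (ln (m i) - bin_entropy (grid R K (th i))))).
  apply: eq_bigr => th _; congr (_ * _); rewrite -letter_entropy.
  rewrite -iid_law_add ?letter_law_sum1//; apply: word_sum_ext => x.
  by rewrite iid_law_ln// => a; exact: letter_law_ge0.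
transitivity (n%:R * \sum_i m i * (\sum_th prior_weight th * (ln (m i)
    - bin_entropy (grid R K (th i))))).
  under eq_bigr do rewrite mulrCA mulr_sumr.
  rewrite -mulr_sumr exchange_big/=; congr (_ * _); apply: eq_bigr => i _.
  by rewrite mulr_sumr; apply: eq_bigr => th _; ring.
congr (_ * _); rewrite -[mean_entropy R K.+1]mul1r -m_sum1 mulr_suml -sumrB.
apply: eq_bigr => i _; rewrite -mulrBr; congr (_ * _).
rewrite (prior_mean_marginal i (fun t => ln (m i) - bin_entropy (grid R K t))).
rewrite -[X in X - _](arcsine_mean_cst K.+1).
rewrite -[X in _ = _ - X]mul1r -mulNr -arcsine_meanZ -arcsine_meanD.
by apply: arcsine_mean_ext => t _; rewrite mulN1r.
Qed.

End Prior.

Lemma cvg_prod_ord (u : nat -> 'I_p -> R) (l : 'I_p -> R) :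
  (forall i, (fun K => u K i) @ \oo --> l i) ->
  (fun K => \prod_i u K i) @ \oo --> \prod_i l i.
Proof.
move=> H; elim: (index_enum 'I_p) => [|i r IH].
  rewrite big_nil (_ : (fun=> _) = fun=> 1); first exact: cvg_cst.
  by apply/funext => K; rewrite big_nil.
rewrite big_cons (_ : (fun=> _) = fun K => u K i * \prod_(j <- r) u K j).
  exact: cvgM.
by apply/funext => K; rewrite big_cons.
Qed.

Lemma mixture_cvg x : (fun K => mixture K x) @ \oo --> urn_law x.
Proof.
rewrite (_ : (fun=> _) = fun K => pair_law (fun _ j l =>
  arcsine_mean K.+1 (fun t => grid R K t ^+ j * (1 - grid R K t) ^+ l)) x).
  apply: cvg_prod_ord => i; apply: cvgMr; exact: moment_cvg.
by apply/funext => K; rewrite mixtureE.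
Qed.

Lemma cvg_word_sum n (u : nat -> seq letter -> R) (l : seq letter -> R) :
  (forall x, (fun K => u K x) @ \oo --> l x) ->
  (fun K => word_sum n (u K)) @ \oo --> word_sum n l.
Proof.
move=> H; rewrite /word_sum; elim: (index_enum _) => [|i r IH].
  rewrite big_nil (_ : (fun=> _) = fun=> 0); first exact: cvg_cst.
  by apply/funext => K; rewrite big_nil.
rewrite big_cons (_ : (fun=> _) = fun K => u K i + \sum_(j <- r) u K j).
  exact: cvgD.
by apply/funext => K; rewrite big_cons.
Qed.

Lemma mixture_entropy_cvg n :
  (fun K => word_sum n (fun x => mixture K x * ln (mixture K x))) @ \oo -->
  word_sum n (fun x => urn_law x * ln (urn_law x)).
Proof.
apply: cvg_word_sum => x; apply: cvgM; first exact: mixture_cvg.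
apply: continuous_cvg; last exact: mixture_cvg.
exact/continuous_ln/urn_law_gt0.
Qed.

Lemma ln_prod_ord (g : 'I_p -> R) : (forall i, 0 < g i) ->
  ln (\prod_i g i) = \sum_i ln (g i).
Proof.
move=> g0; elim: (index_enum 'I_p) => [|i r IH]; first by rewrite !big_nil ln1.
by rewrite !big_cons lnM ?posrE ?prodr_gt0// IH.
Qed.

(** The logarithm of [urn_law] is a sum over the coins, so only the marginals
    of [urn_marginal] are involved. *)
Lemma urn_entropy n :
  word_sum n (fun x => urn_law x * ln (urn_law x)) =
  n%:R * (\sum_i m i * ln (m i)) - \sum_i bin_mean (m i) n (kt_codelength R).
Proof.
transitivity (\sum_i word_sum n (fun x => urn_law x *
    (ln (m i) * (cnt i true x + cnt i false x)%:R +
       ln (kt R (cnt i true x) (cnt i false x))))).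
  rewrite -word_sum_sum; apply: word_sum_ext => x; rewrite -mulr_sumr.
  congr (_ * _); rewrite /urn_law /pair_law ln_prod_ord; last first.
    by move=> i; rewrite mulr_gt0 ?exprn_gt0 ?kt_gt0.
  apply: eq_bigr => i _; rewrite lnM ?posrE ?exprn_gt0 ?kt_gt0// lnXn//.
  by rewrite mulr_natr.
rewrite mulr_sumr -sumrB; apply: eq_bigr => i _.
rewrite (urn_marginal n i (fun j l => ln (m i) * (j + l)%:R + ln (kt R j l))).
transitivity (bin_mean (m i) n (fun k => ln (m i) * k%:R + (-1) * kt_codelength R k)).
  apply: bin_mean_ext => k; rewrite /kt_codelength -arcsine_meanZ.
  rewrite -[X in _ = X + _](arcsine_mean_cst k) -arcsine_meanD.
  by apply: arcsine_mean_ext => j jk; rewrite subnKC//; ring.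
by rewrite bin_meanD !bin_meanZ bin_mean_id; ring.
Qed.

End Pairs.

(** * The information carried by a word about its law *)

Section Info.
Variable R : realType.

(** Each of the two terms is bounded by the tangent line at 1/2. *)
Lemma bin_entropy_le_ln2 (x : R) : 0 <= x <= 1 -> bin_entropy x <= ln 2.
Proof.
move=> /andP[x0 x1].
(* this is ln (1 / (2y)) <= 1 / (2y) - 1, multiplied by y *)
have aux (y : R) : 0 <= y -> - (y * ln y) <= y * ln 2 + 2^-1 - y.
  rewrite le_eqVlt => /predU1P[<-|y0]; first by rewrite !mul0r; lra.
  have := @le_ln1Dx R ((2 * y)^-1 - 1).
  rewrite ltrDr invr_gt0 mulr_gt0// => /(_ isT).
  rewrite (addrC 1) subrK lnV ?posrE ?mulr_gt0// lnM ?posrE// => H.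
  have : y * (- (ln 2 + ln y)) <= y * ((2 * y)^-1 - 1) by rewrite ler_pM2l.
  rewrite [in leRHS]mulrBr (_ : y * (2 * y)^-1 = 2^-1); last first.
    by field; rewrite gt_eqF.
  lra.
have := aux _ x0; have := aux (1 - x); rewrite subr_ge0 => /(_ x1).
rewrite /bin_entropy; lra.
Qed.

Lemma mean_entropy_le_ln2 K : mean_entropy R K <= ln 2.
Proof.
rewrite -[leRHS](arcsine_mean_cst K); apply: arcsine_mean_le => j jK.
apply: bin_entropy_le_ln2; rewrite divr_ge0 ?ler0n//=.
case: K jK => [|K]; first by rewrite leqn0 => /eqP ->; rewrite mul0r.
by move=> jK; rewrite ler_pdivrMr ?ltr0n// mul1r ler_nat.
Qed.

Lemma ln_pi_ge1 : 1 <= ln (pi : R).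
Proof.
(* the midpoint rule is too coarse at pi itself, hence the square root *)
have h : (42 / 25 : R) ^+ 2 <= pi.
  rewrite -ler_sqr ?nnegrE ?pi_ge0 ?sqr_ge0//.
  apply: le_trans (pi_sqr_ge8 R); lra.
have : ln ((42 / 25 : R) ^+ 2) <= ln pi by rewrite ler_ln ?posrE ?pi_gt0// exprn_gt0.
rewrite lnXn// mulr2n.
have := @ln_midpoint R (42 / 25); set l := ln _.
have -> : (1 <= 42 / 25 :> R) by lra.
move=> /(_ isT); lra.
Qed.

(** Up to the discretization error, a mutual information is nonnegative.  For
    [k >= 2] the logarithm in [kt_redundancy_ge] is nonnegative because
    pi >= e, and for [k = 1] the entropy of the toss is the maximal one. *)
Lemma kt_redundancy_ge0 k K : (0 < K)%N -> (k <= K)%N ->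
  0 <= kt_codelength R k - k%:R * mean_entropy R K + k%:R / (2 * K%:R).
Proof.
move=> K0 kK; have dK : 0 <= (2 * K%:R)^-1 :> R by rewrite invr_ge0 mulr_ge0.
case: k kK => [|[|k]] kK.
- rewrite !mul0r subr0 addr0 /kt_codelength /arcsine_mean big_ord1.
  by rewrite subnn kt00 ln1 oppr0 mulr0.
- rewrite mul1r addr_ge0// ?mul1r// subr_ge0.
  apply: (le_trans (mean_entropy_le_ln2 K)).
  rewrite /kt_codelength -[leLHS](arcsine_mean_cst 1).
  apply: arcsine_mean_le => -[|[|j]]// _.
    by rewrite /kt /half_rising /= big_ord0 big_ord1 mul1r add0r divr1 lnV ?posrE// opprK.
  by rewrite /kt /half_rising /= big_ord0 big_ord1 mulr1 add0r divr1 lnV ?posrE// opprK.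
- have := @kt_redundancy_ge R k.+2 K isT kK.
  suff : 0 <= 2^-1 * ln (pi * k.+2%:R / (2 * expR 1)) :> R by lra.
  rewrite mulr_ge0 ?invr_ge0// ln_ge0//.
  have e0 : 0 < 2 * expR 1 :> R by rewrite mulr_gt0 ?expR_gt0.
  rewrite ler_pdivlMr// mul1r mulrC ler_pM ?expR_ge0// ?ler_nat//.
  by rewrite -[leRHS]lnK ?posrE ?pi_gt0// ler_expR ln_pi_ge1.
Qed.

Variables (p : nat) (m : 'I_p -> R).
Hypothesis m_gt0 : forall i, 0 < m i.
Hypothesis m_sum1 : \sum_i m i = 1.

(** For fixed [n] and [K] tending to infinity, [mixture] tends to [urn_law],
    whose entropy is the sum of the mean codelengths of the coins.  Subtracting
    the mean entropy of the letters leaves, for each coin, the binomial mean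
    of the redundancy bounded by [kt_redundancy_ge]. *)
Lemma mixture_information_ge (n : nat) (lam : R) (L : 'I_p -> R) (eta : R) :
  (0 < n)%N -> 0 < lam < 1 -> 0 < eta -> (forall i, 0 <= L i) ->
  (forall i k, 0 < L i -> n%:R * m i * (1 - lam) < k%:R ->
    L i <= 2^-1 * ln (pi * k%:R / (2 * expR 1))) ->
 exists K, \sum_(i < p) L i / (1 + (lam ^+ 2 * (n%:R * m i))^-1) - eta <=
    bayes_information (@prior_weight R p K) (@letter_law R p m K) n.
Proof.
move=> n0 /andP[l0 l1] eta0 L0 Lk.
have eta2 : 0 < eta / 2 by rewrite divr_gt0.
have /cvgrPdist_lt /(_ _ eta2) := mixture_entropy_cvg m_gt0 (n := n).
have : (fun K => n%:R / 2 * harmonic K) @ \oo --> (n%:R / 2 * 0 : R).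
  by apply: cvgMr; exact: cvg_harmonic.
move=> /cvgrPdist_lt /(_ _ eta2) Hh Hm.
have [K [nK] [hK mK]] : exists K, (n <= K)%N /\
   `|n%:R / 2 * 0 - n%:R / 2 * harmonic K| < eta / 2 /\
   `|word_sum n (fun x => urn_law m x * ln (urn_law m x)) -
     word_sum n (fun x => mixture m K x * ln (mixture m K x))| < eta / 2.
  near \oo => K; exists K; split; first by near: K; exact: nbhs_infty_ge.
  by split; near: K.
exists K; rewrite /bayes_information prior_mean_entropy//.
move: hK mK; rewrite mulr0 sub0r normrN ger0_norm; last first.
  by rewrite mulr_ge0 ?divr_ge0 ?ler0n// ltW// harmonic_gt0.
rewrite /harmonic/= => hK; rewrite ltr_norml => /andP[+ _].
rewrite urn_entropy//.
set M := word_sum _ _; set S := \sum_i m i * _ => HM.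
set me := mean_entropy R K.+1.
suff H : \sum_(i < p) L i / (1 + (lam ^+ 2 * (n%:R * m i))^-1) <=
   \sum_i bin_mean (m i) n (kt_codelength R) - n%:R * me + n%:R / 2 / K.+1%:R.
  have aux (T B a e s w : R) : T <= B - a + e -> e < eta / 2 ->
    - (eta / 2) < s - B - w -> T - eta <= s - a - w by lra.
  by rewrite mulrBr; exact: aux H hK HM.
have -> : \sum_i bin_mean (m i) n (kt_codelength R) - n%:R * me + n%:R / 2 / K.+1%:R =
  \sum_i bin_mean (m i) n (fun k => kt_codelength R k - k%:R * me + k%:R / (2 * K.+1%:R)).
  have -> : - (n%:R * me) = \sum_i (- (n%:R * m i * me)).
    by rewrite sumrN; congr (- _); rewrite -mulr_suml -mulr_sumr m_sum1 mulr1.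
  have -> : n%:R / 2 / K.+1%:R = \sum_i (n%:R * m i) / (2 * K.+1%:R) :> R.
    by rewrite -mulr_suml -mulr_sumr m_sum1 mulr1 invfM mulrA.
  rewrite -!big_split/=; apply: eq_bigr => i _.
  transitivity (bin_mean (m i) n (fun k => kt_codelength R k +
     ((- me) * k%:R + (2 * K.+1%:R)^-1 * k%:R))).
    by rewrite !bin_meanD !bin_meanZ bin_mean_id; ring.
  by apply: bin_mean_ext => k; ring.
apply: ler_sum => i _; apply: bin_mean_cantelli => //.
- by rewrite m_gt0 (mass_le1 m_gt0 m_sum1).
- by move=> k kn; apply: kt_redundancy_ge0 => //; rewrite (leq_trans kn)// leqW.
- move=> k kn kL; have [Li|Li] := ltP 0 (L i); last first.
    by rewrite (le_trans Li)// kt_redundancy_ge0// (leq_trans kn)// leqW.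
  have k0 : (0 < k)%N.
    rewrite -(ltr_nat R); apply: le_lt_trans kL.
    by rewrite !mulr_ge0 ?ler0n ?(ltW (m_gt0 _))// subr_ge0 ltW.
  have kK : (k <= K.+1)%N by rewrite (leq_trans kn)// leqW.
  have := @kt_redundancy_ge R k K.+1 k0 kK; rewrite -/me.
  by rewrite lerBlDr; apply: le_trans; exact: Lk Li kL.
Unshelve. all: by end_near.
Qed.

End Info.

(** * Memoryless sources as digit expansions *)

Lemma fsbig_finType (R : realType) (I : finType) (F : I -> \bar R) :
  (\sum_(i \in [set: I]) F i = \sum_i F i)%E.
Proof.
have -> : [set: I] = [set` enum I].
  by apply/seteqP; split => i //= _; rewrite mem_enum.
by rewrite -fsbig_seq ?enum_uniq// big_enum.
Qed.

Section FiniteUnion.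
Context d (T : measurableType d) (R : realType) (mu : {measure set T -> \bar R}).
Variables (I : finType) (F : I -> set T).
Hypothesis mF : forall i, measurable (F i).
Hypothesis tF : trivIset setT F.

Lemma bigcup_finType_measurable : measurable (\bigcup_i F i).
Proof.
apply: fin_bigcup_measurable => // ; exact: finite_finset.
Qed.

Lemma measure_bigcup_finType : mu (\bigcup_i F i) = (\sum_i mu (F i))%E.
Proof.
rewrite measure_fin_bigcup//; last exact: finite_finset.
exact: fsbig_finType.
Qed.
End FiniteUnion.

Section Digits.
Variables (R : realType) (A : finType) (P : A -> R) (a0 : A).
Hypothesis P_ge0 : forall a, 0 <= P a.
Hypothesis P_sum1 : \sum_a P a = 1.
Implicit Types (r : seq A) (u : R).

(** The unit interval is partitioned into intervals of lengths [P a]; the result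
    consists of the letter of the interval containing [u] and of the position
    of [u] in it, rescaled to the unit interval. *)
Fixpoint locate r u : A * R :=
  if r is a :: r' then
    if u < P a then (a, u / P a) else locate r' (u - P a)
  else (a0, u).

Fixpoint low r (a : A) : R :=
  if r is b :: r' then if a == b then 0 else P b + low r' a else 0.

Lemma low_ge0 r a : 0 <= low r a.
Proof.
by elim: r => //= b r IH; case: ifP => // _; rewrite addr_ge0.
Qed.

Lemma low_le r a : a \in r -> low r a + P a <= \sum_(b <- r) P b.
Proof.
elim: r => //= b r IH; rewrite inE big_cons.
case: eqVneq => [-> _|_ /= /IH H].
  by rewrite add0r lerDl sumr_ge0.
by rewrite -addrA lerD2l.
Qed.

Lemma locateP r u : 0 <= u < \sum_(b <- r) P b -> uniq r ->
  [/\ (locate r u).1 \in r,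
      low r (locate r u).1 <= u < low r (locate r u).1 + P (locate r u).1 &
      (locate r u).2 = (u - low r (locate r u).1) / P (locate r u).1].
Proof.
elim: r u => [|b r IH] u.
  by rewrite big_nil => /andP[u0 /(le_lt_trans u0)]; rewrite ltxx.
rewrite big_cons /= => /andP[u0 ur] /andP[br ru].
case: ltP => ub /=.
  by rewrite mem_head eqxx add0r subr0 u0 ub.
have [|//|H1 H2 H3] := IH (u - P b).
  by rewrite subr_ge0 ub ltrBlDl.
set a := (locate _ _).1 in H1 H2 H3 *.
have ab : a == b = false by apply: contraNF br => /eqP <-.
rewrite inE ab H1 H3; split => //; last by rewrite opprD addrA.
by rewrite -lerBrDl -addrA -ltrBlDl.
Qed.

Lemma low_inj r a b u : a \in r -> b \in r ->
  low r a <= u < low r a + P a -> low r b <= u < low r b + P b -> a = b.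
Proof.
elim: r u => //= c r IH u; rewrite !inE.
have [->|ac] := eqVneq a c; have [-> //|bc] := eqVneq b c => /=.
- rewrite add0r => _ br /andP[_ uc] /andP[cu _].
  have : P c < P c.
    by apply: le_lt_trans uc; apply: le_trans cu; rewrite lerDl low_ge0.
  by rewrite ltxx.
- rewrite add0r => ar _ /andP[cu _] /andP[_ uc].
  have : P c < P c.
    by apply: le_lt_trans uc; apply: le_trans cu; rewrite lerDl low_ge0.
  by rewrite ltxx.
- move=> ar br H1 H2; apply: (IH (u - P c)) => //.
  + by rewrite lerBrDl ltrBlDl addrA.
  + by rewrite lerBrDl ltrBlDl addrA.
Qed.

Definition digit u := (locate (enum A) u).1.
Definition expand u := (locate (enum A) u).2.
Definition left_end := low (enum A).

Let sum_enum : \sum_(b <- enum A) P b = 1.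
Proof. by rewrite big_enum. Qed.

Lemma digitP u : 0 <= u < 1 ->
  left_end (digit u) <= u < left_end (digit u) + P (digit u) /\
  expand u = (u - left_end (digit u)) / P (digit u).
Proof. by rewrite -sum_enum => /locateP/(_ (enum_uniq _)) []. Qed.

Lemma digit_uniq u a : 0 <= u < 1 ->
  left_end a <= u < left_end a + P a -> digit u = a.
Proof.
move=> u01; have [H _] := digitP u01; apply: low_inj H.
all: by rewrite mem_enum.
Qed.

Lemma expand_itv u : 0 <= u < 1 -> 0 <= expand u < 1.
Proof.
move=> /digitP[/andP[H1 H2] ->].
have P0 : 0 < P (digit u) by lra.
by rewrite divr_ge0 ?subr_ge0 ?(ltW P0)//= ltr_pdivrMr// mul1r ltrBlDl.
Qed.

Definition digits u (i : nat) : A := digit (iter i expand u).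

Lemma digitsS u i : digits u i.+1 = digits (expand u) i.
Proof. by rewrite /digits iterSr. Qed.

Fixpoint cyl_left (x : seq A) : R :=
  if x is a :: y then left_end a + P a * cyl_left y else 0.

Lemma cyl_left_itv x : 0 <= cyl_left x /\ cyl_left x + iid_law P x <= 1.
Proof.
elim: x => [|a x [IH1 IH2]] /=.
  by rewrite /iid_law big_nil add0r.
rewrite iid_law_cons; split.
  by rewrite addr_ge0 ?low_ge0// mulr_ge0.
rewrite -addrA -mulrDr (@le_trans _ _ (left_end a + P a))//.
  by rewrite lerD2l ler_piMr.
by rewrite -sum_enum low_le// mem_enum.
Qed.

(** Reading digits is the inverse of nesting intervals: the reals whose
    expansion starts with [x] form an interval of length [iid_law P x], so for
    a uniform real the digits are independent of law [P]. *)
Lemma digits_cylP x u : 0 <= u < 1 ->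
  (forall i, (i < size x)%N -> digits u i = nth a0 x i) <->
  cyl_left x <= u < cyl_left x + iid_law P x.
Proof.
elim: x u => [|a x IH] u u01 /=.
  by rewrite /iid_law big_nil add0r; split.
have [c0 c1] := cyl_left_itv x.
rewrite iid_law_cons; split=> [H|H].
  have du : digit u = a by exact: H 0%N isT.
  have [] := digitP u01; rewrite du => /andP[au ua] Eu.
  have Pa : 0 < P a by lra.
  have : forall i, (i < size x)%N -> digits (expand u) i = nth a0 x i.
    by move=> i ix; rewrite -digitsS; exact: H i.+1 ix.
  move=> /(IH _ (expand_itv u01)); rewrite Eu.
  by rewrite ler_pdivlMr// ltr_pdivrMr// lerBrDl ltrBlDl mulrDl !(mulrC _ (P a)) addrA.
have Pa : 0 < P a.
  rewrite lt0r P_ge0 andbT; apply/eqP => Pa0; move: H; rewrite Pa0 !mul0r !addr0.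
  by move=> /andP[/le_lt_trans H /H]; rewrite ltxx.
have ua : left_end a <= u < left_end a + P a.
  move: H => /andP[H1 H2]; rewrite (le_trans _ H1) ?lerDl ?mulr_ge0//=.
  by rewrite (lt_le_trans H2)// -addrA lerD2l -mulrDr ler_piMr.
have du := digit_uniq u01 ua.
have [_] := digitP u01; rewrite du => Eu.
have /(IH _ (expand_itv u01)) Hx :
    cyl_left x <= expand u < cyl_left x + iid_law P x.
  rewrite Eu ler_pdivlMr// ltr_pdivrMr// lerBrDl ltrBlDl mulrDl.
  by rewrite !(mulrC _ (P a)) addrA.
by move=> [|i] ix //; rewrite digitsS Hx.
Qed.

End Digits.

Section UnitMeasure.
Variable R : realType.

(** The uniform law on the half-open unit interval, seen as a law on the real
    line. *)
Definition unit_law : set (measurableTypeR R) -> \bar R :=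
  mrestr (@lebesgue_measure R) (measurable_itv `[0, 1[).

HB.instance Definition _ := Measure.on unit_law.

Let unit_lawT : unit_law setT = 1%E.
Proof.
by rewrite /unit_law /mrestr setTI lebesgue_measure_itv/= lte_fin ltr01 sube0.
Qed.

HB.instance Definition _ :=
  @Measure_isProbability.Build _ _ R unit_law unit_lawT.

End UnitMeasure.

Section IID.
Variables (R : realType) (A : finType) (P : A -> R) (a0 : A).
Hypothesis P_ge0 : forall a, 0 <= P a.
Hypothesis P_sum1 : \sum_a P a = 1.
Variable emb : A -> posnat.

Local Notation dig := (digits P a0).

Definition cyl_itv n (G : pred (n.-tuple A)) (x : n.-tuple A) : set R :=
  if G x then `[cyl_left P x, cyl_left P x + iid_law P x[%classic else set0.

Lemma digits_eventE n (G : pred (n.-tuple A)) :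
  [set u : R | 0 <= u < 1 /\ G [tuple dig u i | i < n]] = \bigcup_x cyl_itv G x.
Proof.
have tupP (u : R) (x : n.-tuple A) : [tuple dig u i | i < n] = x <->
    (forall i, (i < size x)%N -> dig u i = nth a0 x i).
  rewrite size_tuple; split=> [<- i ix|H].
    by rewrite -(tnth_nth a0 _ (Ordinal ix)) tnth_mktuple.
  by apply: eq_from_tnth => i; rewrite tnth_mktuple H// (tnth_nth a0).
apply/seteqP; split=> u.
  move=> [u01 Gu]; exists [tuple dig u i | i < n] => //.
  rewrite /cyl_itv Gu/= in_itv/=.
  apply/(digits_cylP a0 P_ge0 P_sum1 _ u01).
  exact: (tupP u [tuple dig u i | i < n]).1 erefl.
move=> [x _]; rewrite /cyl_itv; case: ifP => // Gx /=; rewrite in_itv/= => xu.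
have [c0 c1] := cyl_left_itv P_ge0 P_sum1 x.
have u01 : 0 <= u < 1.
  by move: xu => /andP[H1 H2]; rewrite (le_trans c0 H1) (lt_le_trans H2 c1).
by split => //; move/(digits_cylP a0 P_ge0 P_sum1 _ u01) : xu => /(tupP u x).2 ->.
Qed.

Lemma cyl_itv_measurable n (G : pred (n.-tuple A)) x : measurable (cyl_itv G x).
Proof. by rewrite /cyl_itv; case: ifP => // _; exact: measurable_itv. Qed.

Lemma cyl_itv_trivI n (G : pred (n.-tuple A)) : trivIset setT (cyl_itv G).
Proof.
apply/trivIsetP => x y _ _ xy; apply/seteqP; split=> u //= [].
rewrite /cyl_itv; case: ifP => // Gx; case: ifP => // Gy /=.
rewrite !in_itv/= => xu yu.
have [c0 c1] := cyl_left_itv P_ge0 P_sum1 x.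
have u01 : 0 <= u < 1.
  by move: xu => /andP[H1 H2]; rewrite (le_trans c0 H1) (lt_le_trans H2 c1).
move/(digits_cylP a0 P_ge0 P_sum1 _ u01) : xu => Hx.
move/(digits_cylP a0 P_ge0 P_sum1 _ u01) : yu => Hy.
case/eqP: xy; apply: eq_from_tnth => i; rewrite !(tnth_nth a0).
by rewrite -Hx ?size_tuple// -Hy ?size_tuple.
Qed.

Lemma digits_event_measurable n (G : pred (n.-tuple A)) :
  measurable [set u : R | 0 <= u < 1 /\ G [tuple dig u i | i < n]].
Proof.
rewrite digits_eventE; apply: bigcup_finType_measurable.
exact: cyl_itv_measurable.
Qed.

Lemma digits_event_measure n (G : pred (n.-tuple A)) :
  (@lebesgue_measure R [set u : R | (0 <= u < 1)%R /\ G [tuple dig u i | i < n]] =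
    (\sum_(x : n.-tuple A | G x) iid_law P x)%R%:E)%E.
Proof.
rewrite digits_eventE measure_bigcup_finType; last 2 first.
- exact: cyl_itv_measurable.
- exact: cyl_itv_trivI.
rewrite -sumEFin [RHS]big_mkcond/=; apply: eq_bigr => x _; rewrite /cyl_itv.
case: ifP => _; last by rewrite measure0.
rewrite lebesgue_measure_itv/= lte_fin ltrDl -EFinB addrAC subrr add0r.
case: ltP => // H; congr EFin; apply/eqP; rewrite eq_le H andbT.
by apply: prodr_ge0 => a _.
Qed.

(** Outside the unit interval, which carries the whole mass, the value is
    arbitrary; a constant one keeps the function measurable. *)
Definition stream (u : measurableTypeR R) : g_sigma_algebraType cylinders :=
  fun i => if 0 <= u < 1 then emb (dig u i) else emb a0.

Lemma stream_measurable : measurable_fun setT stream.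
Proof.
apply: (@measurability _ _ _ _ setT stream cylinders) => //.
move=> _ [_ [i [B ->]] <-]; rewrite setTI.
have -> : stream @^-1` [set w | B (w i)] =
  [set u | 0 <= u < 1 /\ `[< B (emb (tnth [tuple dig u j | j < i.+1] ord_max)) >]]
  `|` (if `[< B (emb a0) >] then ~` `[0, 1[ else set0).
  apply/seteqP; split=> u; rewrite /stream /preimage/=.
    case: ifP => u01 Bu; [left; split => //|right].
      by apply/asboolP; rewrite tnth_mktuple.
    by rewrite asboolT//= in_itv/= u01.
  case=> [[-> /asboolP]|]; first by rewrite tnth_mktuple.
  by case: asboolP => //= Ba; rewrite in_itv/= => /negP/negbTE ->.
apply: measurableU.
  exact: (@digits_event_measurable i.+1 (fun x => `[< B (emb (tnth x ord_max)) >])).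
case: ifP => // _; apply: measurableC; exact: measurable_itv.
Qed.

HB.instance Definition _ := isMeasurableFun.Build _ _ _ _ stream stream_measurable.

Definition iid_source : source R := distribution (@unit_law R) stream.

Lemma iid_sourceE n (B : nat -> set posnat) :
  iid_source [set w | forall i, (i < n)%N -> B i (w i)] =
  (\prod_(i < n) \sum_(a | `[< B i (emb a) >]) P a)%:E.
Proof.
rewrite /iid_source /distribution /pushforward /unit_law /= /mrestr.
transitivity (@lebesgue_measure R [set u : R | 0 <= u < 1 /\
    (fun x : n.-tuple A => [forall i : 'I_n, `[< B i (emb (tnth x i)) >]])
      [tuple dig u i | i < n]]).
  congr (lebesgue_measure _); apply/seteqP; split=> u /=; rewrite in_itv/= /stream.
    move=> [H u01]; split => //; apply/forallP => i; apply/asboolP.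
    by rewrite tnth_mktuple; have := H i (ltn_ord i); rewrite u01.
  move=> [u01 /forallP H]; split => // i ni.
  by have /asboolP := H (Ordinal ni); rewrite tnth_mktuple u01.
rewrite (digits_event_measure (fun x : n.-tuple A =>
  [forall i : 'I_n, `[< B i (emb (tnth x i)) >]])); congr EFin.
under [RHS]eq_bigr do rewrite big_mkcond/=.
rewrite bigA_distr_bigA/= big_mkcond/=.
rewrite (reindex (fun g : {ffun 'I_n -> A} => [tuple g i | i < n]))/=; last first.
  exists (fun x : n.-tuple A => [ffun i => tnth x i]) => x _.
    by apply/ffunP => i; rewrite ffunE tnth_mktuple.
  by apply: eq_from_tnth => i; rewrite tnth_mktuple ffunE.
apply: eq_bigr => g _; case: forallP => [H|H].
  rewrite /iid_law big_map big_enum/=; apply: eq_bigr => i _.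
  by have := H i; rewrite tnth_mktuple => ->.
have [i Hi] : exists i : 'I_n, ~~ `[< B i (emb (g i)) >].
  apply: contrapT => K; apply: H => i; rewrite tnth_mktuple.
  by apply: contrapT => /negP Ki; apply: K; exists i.
by rewrite (bigD1 i)//= (negbTE Hi) mul0r.
Qed.

Lemma iid_source1 i (B : set posnat) :
  iid_source [set w | B (w i)] = (\sum_(a | `[< B (emb a) >]) P a)%:E.
Proof.
have -> : [set w : nat -> posnat | B (w i)] =
  [set w | forall j, (j < i.+1)%N -> (if j == i then B else setT) (w j)].
  apply/seteqP; split=> w /=; first by move=> Bw j _; case: eqP => // ->.
  by move=> /(_ i (ltnSn i)); rewrite eqxx.
rewrite (iid_sourceE i.+1 (fun j => if j == i then B else setT)).
rewrite big_ord_recr/= eqxx big1 ?mul1r// => j _.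
rewrite ltn_eqF// -[RHS]P_sum1; apply: eq_bigl => a.
by apply/asboolP.
Qed.

Lemma iid_source_memoryless : memoryless iid_source.
Proof.
split=> [i B|n B]; first by rewrite !iid_source1.
rewrite iid_sourceE -prodEFin; apply: eq_bigr => i _.
by rewrite iid_source1.
Qed.

End IID.

(** * Divergence of laws with finite support *)

Lemma esum_finite_range (R : realType) (I : finType) (T : choiceType)
    (h : I -> T) (a : T -> \bar R) :
  injective h -> (forall x, 0 <= a x)%E ->
  (forall x, ~ range h x -> a x = 0%E) ->
  (\esum_(x in [set: T]) a x = \sum_i a (h i))%E.
Proof.
move=> hI a0 aN.
transitivity (\esum_(x in range h) a x)%E.
  rewrite [RHS]esum_mkcond; apply: eq_esum => x _.
  by case: ifPn => //; rewrite notin_setE => /aN.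
rewrite esum_fset//; last exact/finite_image/finite_finset.
rewrite fsbig_image; last by move=> x y _ _; exact: hI.
exact: fsbig_finType.
Qed.

Lemma tuple_set1_measurable n (x : n.-tuple posnat) : measurable [set x].
Proof.
have -> : [set x] = \bigcap_(i : 'I_n) ((@tnth n posnat)^~ i @^-1` [set tnth x i]).
  apply/seteqP; split=> y /=; first by move=> -> i _.
  by move=> H; apply: eq_from_tnth => i; exact: H.
apply: fin_bigcap_measurable; first exact: finite_finset.
move=> i _; rewrite -[X in measurable X]setTI; apply: measurable_tnth => //.
Qed.

Section Divergence.
Variables (R : realType) (I : finType) (n : nat) (h : I -> n.-tuple posnat).
Hypothesis hI : injective h.

Lemma probability_range_le1 (Q : probability (n.-tuple posnat) R) :
  \sum_i fine (Q [set h i]) <= 1.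
Proof.
have fQ (x : n.-tuple posnat) : Q [set x] \is a fin_num.
  by apply: fin_num_measure; exact: tuple_set1_measurable.
rewrite -lee_fin -sumEFin.
under eq_bigr do rewrite fineK//.
rewrite -(measure_bigcup_finType Q (F := fun i => [set h i])).
- apply: probability_le1; apply: bigcup_finType_measurable => i.
  exact: tuple_set1_measurable.
- by move=> i; exact: tuple_set1_measurable.
- by apply/trivIsetP => i j _ _ ij; apply/seteqP; split=> x //= [-> /hI/eqP];
    rewrite (negbTE ij).
Qed.

(** Only the sum of the positive parts may be infinite, so the lower bounds on
    the terms can be added up. *)
Lemma divergence_ge (P Q : set (n.-tuple posnat) -> \bar R) (b : I -> R) :
  (forall x, ~ range h x -> P [set x] = 0%E) ->
  (forall i, (b i)%:E <=
     divergence_term (fine (P [set h i])) (fine (Q [set h i])))%E ->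
  ((\sum_i b i)%:E <= divergence P Q)%E.
Proof.
move=> PN bt; rewrite /divergence.
set t := fun x => divergence_term _ _.
have tN x : ~ range h x -> t x = 0%E.
  by move=> /PN Px; rewrite /t /divergence_term Px /= eqxx.
rewrite !(@esum_finite_range R I _ h)//; last 2 first.
- by move=> x /tN; rewrite funenegE => ->; rewrite oppe0 maxxx.
- by move=> x /tN; rewrite funeposE => ->; rewrite maxxx.
have tny i : t (h i) != -oo%E by have := bt i; rewrite -/(t (h i)); case: (t _).
have tneg i : (t^\- (h i))%E \is a fin_num.
  rewrite funenegE; have := tny i; case: (t (h i)) => [r| |]//= _.
    by rewrite maxEle; case: ifP.
  by rewrite maxEle leNye.
rewrite leeBrDr; last by rewrite sum_fin_num; apply/allP => _ /mapP[i _ ->]; exact: tneg.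
rewrite -sumEFin -big_split/=; apply: lee_sum => i _.
have := bt i; rewrite -/(t (h i)) funenegE funeposE.
case: (t (h i)) => [r| |]//=; last by rewrite maxye leey.
rewrite lee_fin => br; rewrite -!EFin_max -EFinD lee_fin.
by have [r0|r0] := leP r 0; have [r1|r1] := leP (- r) 0; lra.
Qed.

End Divergence.

Section IIDBlock.
Variables (R : realType) (A : finType) (P : A -> R) (a0 : A).
Hypothesis P_ge0 : forall a, 0 <= P a.
Hypothesis P_sum1 : \sum_a P a = 1.
Variable emb : A -> posnat.
Hypothesis emb_inj : injective emb.

Local Notation S := (iid_source a0 P_ge0 P_sum1 emb).

Lemma block_law_set1 n (x : n.-tuple posnat) :
  block_law S n [set x] = (\prod_(i < n) \sum_(a | emb a == tnth x i) P a)%:E.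
Proof.
pose B i : set posnat := [set y | y = nth (emb a0) x i].
transitivity (S [set w | forall i, (i < n)%N -> B i (w i)]).
  rewrite /block_law /pushforward; congr (S _); apply/seteqP; split=> w /=.
    by move=> H i ni; rewrite /B/= -H -(tnth_nth _ (block n w) (Ordinal ni)) tnth_mktuple.
  by move=> H; apply: eq_from_tnth => i; rewrite tnth_mktuple H// (tnth_nth (emb a0)).
rewrite iid_sourceE; congr EFin; apply: eq_bigr => i _; apply: eq_bigl => a.
by rewrite (tnth_nth (emb a0)); apply/asboolP/eqP.
Qed.

Lemma block_law_emb n (y : n.-tuple A) :
  block_law S n [set map_tuple emb y] = (iid_law P y)%:E.
Proof.
rewrite block_law_set1 /iid_law big_tuple; congr EFin; apply: eq_bigr => i _.
rewrite tnth_map (big_pred1 (tnth y i))// => a.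
by rewrite (inj_eq emb_inj).
Qed.

Lemma block_law_out n (x : n.-tuple posnat) :
  ~ range (@map_tuple n _ _ emb) x -> block_law S n [set x] = 0%E.
Proof.
move=> xN; rewrite block_law_set1.
have [i iN] : exists i, forall a, emb a != tnth x i.
  apply: contrapT => H; apply: xN.
  have Ha i : exists a, emb a == tnth x i.
    apply: contrapT => K; apply: H; exists i => a; apply/negP => E.
    by apply: K; exists a.
  exists [tuple xchoose (Ha i) | i < n] => //.
  apply: eq_from_tnth => i; rewrite tnth_map tnth_mktuple.
  exact/eqP/(xchooseP (Ha i)).
by rewrite (bigD1 i)//= big_pred0 ?mul0r// => a; apply/negbTE.
Qed.

Lemma map_emb_inj n : injective (@map_tuple n _ _ emb).
Proof.
move=> x y H; apply: eq_from_tnth => i; apply: emb_inj.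
by have := congr1 (fun z => tnth z i) H; rewrite !tnth_map.
Qed.

Lemma iid_law_le1 n (y : n.-tuple A) : 0 <= iid_law P y <= 1.
Proof.
have P1 a : P a <= 1 by rewrite -P_sum1 (bigD1 a)//= lerDl sumr_ge0.
rewrite /iid_law prodr_ge0//=; apply: prodr_ile1 => a _.
by rewrite P_ge0 P1.
Qed.

Lemma entropy_iid_lty n : (entropy S n < +oo)%E.
Proof.
rewrite /entropy (@esum_finite_range R _ _ (@map_tuple n _ _ emb)).
- rewrite (_ : (\sum_i _)%E = (\sum_(y : n.-tuple A)
    - (iid_law P y * log2 (iid_law P y)))%:E) ?ltry//.
  rewrite -sumEFin; apply: eq_bigr => y _.
  by rewrite block_law_emb.
- exact: map_emb_inj.
- move=> x; have [[y _ <-]|xN] := pselect (range (@map_tuple n _ _ emb) x); last first.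
    by rewrite block_law_out//= mul0r oppr0.
  rewrite block_law_emb/= lee_fin oppr_ge0 mulr_ge0_le0//.
    by have /andP[] := iid_law_le1 y.
  rewrite /log2 pmulr_lle0; last by rewrite invr_gt0 ln_gt0// ltr1n.
  by rewrite ln_le0//; have /andP[] := iid_law_le1 y.
- by move=> x xN; rewrite block_law_out//= mul0r oppr0.
Qed.

End IIDBlock.

(** * Minimax redundancy and Bayes redundancy *)

Section Bayes.
Variables (R : realType) (A Th : finType) (W : Th -> R) (P : Th -> A -> R) (a0 : A).
Hypothesis W_gt0 : forall th, 0 < W th.
Hypothesis W_sum1 : \sum_th W th = 1.
Hypothesis P_ge0 : forall th a, 0 <= P th a.
Hypothesis P_sum1 : forall th, \sum_a P th a = 1.
Variable emb : A -> posnat.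
Hypothesis emb_inj : injective emb.

Local Notation bayes_mixture := (bayes_mixture W P).
Local Notation bayes_information := (bayes_information W P).

Let ln2_gt0 : 0 < ln 2 :> R.
Proof. by rewrite ln_gt0// ltr1n. Qed.

Lemma iid_law_ge0 th (x : seq A) : 0 <= iid_law (P th) x.
Proof. by apply: prodr_ge0. Qed.

Lemma bayes_mixture_ge0 x : 0 <= bayes_mixture x.
Proof. by apply: sumr_ge0 => th _; rewrite mulr_ge0 ?(ltW (W_gt0 _))// iid_law_ge0. Qed.

(** The inequality [ln (q / M) <= q / M - 1] replaces [q] by a reference value
    [M].  The bound is affine in [q], hence easy to average, and it covers the
    infinite term at [q = 0]. *)
Lemma divergence_term_ge (pr q M : R) : 0 <= pr -> 0 <= q -> 0 <= M ->
  (pr != 0 -> M != 0) ->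
  (((pr * ln pr - pr * ln M + pr - pr * (q / M)) / ln 2)%:E <=
    divergence_term pr q)%E.
Proof.
move=> p0 q0 M0 pM; rewrite /divergence_term.
have [->|pN] := eqVneq pr 0; first by rewrite !mul0r subr0 addr0 subr0 mul0r.
have [//|qN] := eqVneq q 0; first by rewrite leey.
have pP : 0 < pr by rewrite lt0r pN.
have qP : 0 < q by rewrite lt0r qN.
have MP : 0 < M by rewrite lt0r pM.
rewrite lee_fin /log2 [in leRHS]mulrA ler_pM2r ?invr_gt0//.
rewrite ln_div ?posrE//.
have := @le_ln1Dx R (q / M - 1).
rewrite ltrDr divr_gt0// (addrC 1) subrK ln_div ?posrE// => /(_ isT) H.
have : pr * (ln q - ln M) <= pr * (q / M - 1) by rewrite ler_pM2l.
lra.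
Qed.

(** With [M] the Bayes mixture, the affine correction of [divergence_term_ge]
    averages to at least [1 - Q(S)], where [S] is the finite support of the
    sources; this is nonnegative since [Q] is a probability. *)
Lemma minimax_redundancy_ge_bayes (C : set (source R)) n :
  (forall th, C (iid_source a0 (P_ge0 th) (P_sum1 th) emb)) ->
  (((bayes_information n) / ln 2)%:E <= minimax_redundancy (block_laws C n))%E.
Proof.
move=> HC; apply: le_ereal_inf_tmp => _ [Q _ <-].
set s := ereal_sup _.
pose h := @map_tuple n _ _ emb.
pose q (y : n.-tuple A) := fine (Q [set h y]).
have q0 y : 0 <= q y by rewrite /q fine_ge0.
have q1 : \sum_y q y <= 1 by apply: probability_range_le1; exact: map_emb_inj.
pose b th (y : n.-tuple A) := (iid_law (P th) y * ln (iid_law (P th) y)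
   - iid_law (P th) y * ln (bayes_mixture y) + iid_law (P th) y
   - iid_law (P th) y * (q y / bayes_mixture y)) / ln 2.
have bs th : ((\sum_y b th y)%:E <= s)%E.
  apply: le_trans; last first.
    apply: ereal_sup_ubound; exists (block_law (iid_source a0 (P_ge0 th) (P_sum1 th) emb) n) => //.
    by exists (iid_source a0 (P_ge0 th) (P_sum1 th) emb).
  apply: (divergence_ge (h := h)).
  - exact: map_emb_inj.
  - by move=> x; exact: block_law_out.
  - move=> y; rewrite block_law_emb// /=; apply: divergence_term_ge => //.
    + exact: iid_law_ge0.
    + exact: bayes_mixture_ge0.
    + move=> p0; rewrite gt_eqF// (@lt_le_trans _ _ (W th * iid_law (P th) y))//.
        by rewrite mulr_gt0// lt0r p0 iid_law_ge0.
      rewrite /bayes_mixture (bigD1 th)//= lerDl sumr_ge0// => t _.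
      by rewrite mulr_ge0 ?iid_law_ge0 ?(ltW (W_gt0 _)).
have Wb : bayes_information n / ln 2 <= \sum_th W th * \sum_y b th y.
  have -> : \sum_th W th * \sum_y b th y =
      (\sum_th W th * word_sum n (fun x => iid_law (P th) x * ln (iid_law (P th) x))
       + \sum_(y : n.-tuple A) (- (bayes_mixture y * ln (bayes_mixture y))
         + bayes_mixture y - bayes_mixture y * (q y / bayes_mixture y))) / ln 2.
    transitivity (\sum_(y : n.-tuple A) \sum_th W th * b th y).
      by rewrite exchange_big/=; apply: eq_bigr => th _; rewrite mulr_sumr.
    rewrite /word_sum; under [in RHS]eq_bigr do rewrite mulr_sumr.
    rewrite [in RHS]exchange_big/= -big_split/= mulr_suml; apply: eq_bigr => y _.
    transitivity (\sum_th (W th * (iid_law (P th) y * ln (iid_law (P th) y)) +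
       W th * iid_law (P th) y * (1 - ln (bayes_mixture y) - q y / bayes_mixture y)) / ln 2).
      by apply: eq_bigr => th _; rewrite /b; ring.
    rewrite -mulr_suml big_split/= -mulr_suml -/(bayes_mixture y).
    by congr (_ / _); ring.
  rewrite ler_pM2r ?invr_gt0// /bayes_information lerD2l.
  rewrite /word_sum -sumrN -subr_ge0 -sumrB.
  have M1 : \sum_(y : n.-tuple A) bayes_mixture y = 1.
    rewrite /bayes_mixture exchange_big/= -[RHS]W_sum1; apply: eq_bigr => th _.
    by rewrite -mulr_sumr -/(word_sum n (iid_law (P th))) iid_law_sum1// mulr1.
  apply: (@le_trans _ _ (\sum_(y : n.-tuple A) (bayes_mixture y - q y))).
    by rewrite sumrB M1 subr_ge0.
  apply: ler_sum => y _; have [M0|M0] := eqVneq (bayes_mixture y) 0.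
    by rewrite M0 !mul0r; have := q0 y; lra.
  by rewrite le_eqVlt; apply/orP; left; apply/eqP; field.
case: s bs => [r| |] bs; last 2 first.
- by rewrite leey.
- have [th _] : exists2 th : Th, th \in Th & W th != 0.
    apply: contrapT => H; move: W_sum1; rewrite big1 => [/esym/eqP|th _].
      by rewrite oner_eq0.
    by apply/eqP/negPn/negP => Wth; apply: H; exists th.
  by have := bs th.
rewrite lee_fin (le_trans Wb)//.
rewrite -[leRHS]mul1r -W_sum1 mulr_suml; apply: ler_sum => th _.
by rewrite ler_pM2l// -lee_fin bs.
Qed.
End Bayes.

(** With [i] counted from 0, the letters [(i, true)] and [(i, false)] are the
    symbols 2i + 1 and 2i + 2. *)
(** * The envelope class *)

Definition pair_symbol p (a : 'I_p * bool) : posnat :=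
  exist _ (a.1.*2 + ~~ a.2).+1 (ltn0Sn _).

Lemma pair_symbol_inj p : injective (@pair_symbol p).
Proof.
move=> [i b] [j b'] /(congr1 val)/= [H].
have bb : b = b'.
  by have := congr1 odd H; rewrite !oddD !odd_double; case: b b' {H} => -[].
rewrite bb in H *; congr pair; apply: val_inj => /=.
by apply: double_inj; move/addIn : H.
Qed.

Lemma pair_symbol_le p (a : 'I_p * bool) : (val (pair_symbol a) <= 2 * a.1.+1)%N.
Proof.
case: a => i b /=; rewrite mul2n doubleS ltnS addnC.
by case: b => //=; rewrite ?add0n ?add1n // leqnSn.
Qed.

Section Envelope.
Variables (R : realType) (f : nat -> R).
Hypothesis f01 : forall x : nat, (0 < x)%N -> 0 <= f x <= 1.
Hypothesis f_noninc : forall x y : nat, (0 < x)%N -> (x <= y)%N -> f y <= f x.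
Variables (p : nat) (p_gt0 : (0 < p)%N).
Hypothesis cp_gt1 : 1 < csum f p.
Hypothesis f2p_gt0 : 0 < f (2 * p)%N.

Definition pair_mass (i : 'I_p) : R := f (2 * i.+1)%N / csum f p.

Lemma csumE : csum f p = \sum_(i < p) f (2 * i.+1)%N.
Proof. by rewrite /csum big_add1 big_mkord. Qed.

Lemma csum_gt0 : 0 < csum f p.
Proof. exact: lt_trans cp_gt1. Qed.

Lemma f_even_ge (i : 'I_p) : f (2 * p)%N <= f (2 * i.+1)%N.
Proof. by apply: f_noninc => //; rewrite leq_mul2l ltn_ord orbT. Qed.

Lemma pair_mass_gt0 i : 0 < pair_mass i.
Proof. by rewrite divr_gt0 ?csum_gt0// (lt_le_trans f2p_gt0)// f_even_ge. Qed.

Lemma pair_mass_sum1 : \sum_i pair_mass i = 1.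
Proof. by rewrite -mulr_suml -csumE divff// gt_eqF// csum_gt0. Qed.

(** The mass of a letter of the pair [i] is at most [f (2 * i.+1) / csum f p],
    hence at most [f (2 * i.+1)], which [f] dominates on the whole pair. *)
Lemma iid_source_envelope K (th : {ffun 'I_p -> 'I_K.+2}) (a0 : 'I_p * bool)
    (P_ge0 : forall a, 0 <= letter_law pair_mass th a)
    (P_sum1 : \sum_a letter_law pair_mass th a = 1) :
  envelope_class f (iid_source a0 P_ge0 P_sum1 (@pair_symbol p)).
Proof.
split.
- exact: iid_source_memoryless.
- by move=> n; apply: entropy_iid_lty; exact: pair_symbol_inj.
move=> x; have [[y _ xy]|xN] :=
    pselect (range (@map_tuple 1 _ _ (@pair_symbol p)) [tuple x]); last first.
  by rewrite block_law_out// lee_fin; have /andP[] := f01 (valP x).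
rewrite -xy block_law_emb; last exact: pair_symbol_inj.
rewrite lee_fin; case/tupleP: y xy => a y xy; rewrite (tuple0 y) /iid_law big_seq1.
have -> : x = pair_symbol a by have := congr1 (fun t => thead t) xy.
apply: (le_trans (letter_law_le pair_mass_gt0 _ _)).
apply: (@le_trans _ _ (f (2 * a.1.+1)%N)).
  rewrite /pair_mass ler_pdivrMr ?csum_gt0// ler_peMr ?(ltW cp_gt1)//.
  by have /andP[] := @f01 (2 * a.1.+1)%N isT.
by apply: f_noninc => //; exact: pair_symbol_le.
Qed.

(** The sharper bound, free of [eps], of which the theorem is a weakening. *)
Lemma minimax_redundancy_envelope_ge (n : nat) (lam : R) (L : 'I_p -> R) :
  (0 < n)%N -> 0 < lam < 1 -> (forall i, 0 <= L i) ->
  (forall i k, 0 < L i -> n%:R * pair_mass i * (1 - lam) < k%:R ->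
    L i <= 2^-1 * ln (pi * k%:R / (2 * expR 1))) ->
  (((\sum_(i < p) L i / (1 + (lam ^+ 2 * (n%:R * pair_mass i))^-1)) / ln 2)%:E
    <= minimax_redundancy (block_laws (envelope_class f) n))%E.
Proof.
move=> n0 lam01 L0 Lk; apply/lee_addgt0Pr => e e0.
have ln2_gt0 : 0 < ln 2 :> R by rewrite ln_gt0// ltr1n.
have eta0 : 0 < e * ln 2 by rewrite mulr_gt0.
have [K HK] := mixture_information_ge pair_mass_gt0 pair_mass_sum1 n0 lam01
  eta0 L0 Lk.
have := @minimax_redundancy_ge_bayes R ('I_p * bool)%type {ffun 'I_p -> 'I_K.+2}
  (@prior_weight R p K) (@letter_law R p pair_mass K) (Ordinal p_gt0, true)
  (@prior_weight_gt0 R p K) (@prior_weight_sum1 R p K)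
  (@letter_law_ge0 R p pair_mass pair_mass_gt0 K)
  (@letter_law_sum1 R p pair_mass pair_mass_sum1 K)
  (@pair_symbol p) (@pair_symbol_inj p) (envelope_class f) n
  (fun th => iid_source_envelope _ _ _).
move=> H; rewrite -leeBlDr//; apply: le_trans H.
rewrite -EFinB lee_fin ler_pdivlMr// mulrBl divfK ?gt_eqF//.
Qed.

End Envelope.

Theorem theorem5 (R : realType) (f : nat -> R)
  (f01 : forall x : nat, (0 < x)%N -> 0 <= f x <= 1)
  (f_noninc : forall x y : nat, (0 < x)%N -> (x <= y)%N -> f y <= f x)
  (f_summable : cvgn (fun m : nat => \sum_(1 <= x < m.+1) f x : R))
  (c_oo : 1 < limn (csum f))
  (p : nat) (p_gt0 : (0 < p)%N) (cp_gt1 : 1 < csum f p)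
  (n : nat) (n_gt0 : (0 < n)%N)
  (eps : R) (eps_gt0 : 0 < eps)
  (lam : R) (lam01 : 0 < lam < 1)
  (f2p_gt0 : 0 < f (2 * p)%N)
  (n_large : csum f p / f (2 * p)%N * (10 / (eps * (1 - lam))) < n%:R) :
  ((Cconst f p n lam eps *
    \sum_(1 <= i < p.+1)
      (1 / 2 * log2 (n%:R * (1 - lam) * pi * f (2 * i)%N
                     / (2 * csum f p * expR 1)) - eps))%:E
   <= minimax_redundancy (block_laws (envelope_class f) n))%E.
Proof.
have [l0 l1] := andP lam01.
have c0 := csum_gt0 cp_gt1.
have ln2_gt0 : 0 < ln 2 :> R by rewrite ln_gt0// ltr1n.
have nR : (0 : R) < n%:R by rewrite ltr0n.
have l1' : 0 < 1 - lam by rewrite subr_gt0.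
have fi0 (i : 'I_p) : 0 < f (2 * i.+1)%N.
  by rewrite (lt_le_trans f2p_gt0)// f_even_ge.
pose x (i : nat) : R := n%:R * (1 - lam) * pi * f (2 * i.+1)%N / (2 * csum f p * expR 1).
pose L (i : 'I_p) := Num.max 0 (2^-1 * ln (x i)).
have xE (i : 'I_p) : x i = pi * (n%:R * pair_mass f i * (1 - lam)) / (2 * expR 1).
  by rewrite /x /pair_mass; field; rewrite !gt_eqF ?expR_gt0.
have x0 (i : 'I_p) : 0 < x i.
  by rewrite divr_gt0 ?mulr_gt0 ?expR_gt0 ?pi_gt0.
have L0 i : 0 <= L i by rewrite /L le_max lexx.
have Lk i k : 0 < L i -> n%:R * pair_mass f i * (1 - lam) < k%:R ->
    L i <= 2^-1 * ln (pi * k%:R / (2 * expR 1)).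
  rewrite /L lt_max ltxx => H kL; rewrite (max_r (ltW H)).
  rewrite ler_pM2l ?invr_gt0// ler_ln ?posrE//; last first.
    rewrite divr_gt0 ?mulr_gt0 ?expR_gt0 ?pi_gt0//.
    apply: le_lt_trans kL; apply: mulr_ge0; last exact: ltW.
    by apply: mulr_ge0; [exact: ler0n|exact/ltW/pair_mass_gt0].
  rewrite xE ler_pM2r ?invr_gt0 ?mulr_gt0 ?expR_gt0// ler_pM2l ?pi_gt0//.
  exact: ltW.
apply: le_trans (minimax_redundancy_envelope_ge f01 f_noninc p_gt0 cp_gt1
  f2p_gt0 n_gt0 lam01 L0 Lk).
rewrite lee_fin big_add1 big_mkord mulr_suml mulr_sumr; apply: ler_sum => i _.
rewrite -/(x i) /Cconst.
set C1 := 1 / (1 + _); set z := 5 * _ / _.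
have z0 : 0 <= z by rewrite divr_ge0 ?mulr_ge0 ?ltW.
have z1 : 2 * z <= 1.
  have d0 : 0 < (1 - lam) * eps * n%:R * f (2 * p)%N by rewrite !mulr_gt0.
  rewrite mulrA ler_pdivrMr// mul1r.
  have : csum f p / f (2 * p)%N * (10 / (eps * (1 - lam))) *
     (f (2 * p)%N * (eps * (1 - lam))) <= n%:R * (f (2 * p)%N * (eps * (1 - lam))).
    by rewrite ler_pM2r ?ltW// !mulr_gt0.
  have -> : csum f p / f (2 * p)%N * (10 / (eps * (1 - lam))) *
     (f (2 * p)%N * (eps * (1 - lam))) = 10 * csum f p.
    by field; rewrite !gt_eqF.
  lra.
(* the second factor is nonnegative because z < 1/2 and pi ^ 2 >= 8 *)
have C2 : 0 <= 1 - 4 / pi * Num.sqrt z <= 1.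
  rewrite subr_ge0 gerBl mulr_ge0 ?divr_ge0 ?invr_ge0 ?pi_ge0 ?sqrtr_ge0// andbT.
  rewrite -ler_sqr ?nnegrE ?mulr_ge0 ?divr_ge0 ?invr_ge0 ?pi_ge0 ?sqrtr_ge0//.
  rewrite exprMn sqr_sqrtr// expr1n.
  apply: le_trans z1; rewrite ler_wpM2r// expr_div_n ler_pdivrMr ?exprn_gt0 ?pi_gt0//.
  by have := pi_sqr_ge8 R; lra.
have C1i : 0 <= C1 <= (1 + (lam ^+ 2 * (n%:R * pair_mass f i))^-1)^-1.
  have d0 : 0 <= csum f p / (lam ^+ 2 * n%:R * f (2 * p)%N).
    by rewrite divr_ge0 ?mulr_ge0 ?sqr_ge0 ?ltW.
  have d1 : (lam ^+ 2 * (n%:R * pair_mass f i))^-1 =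
      csum f p / (lam ^+ 2 * n%:R * f (2 * i.+1)%N).
    by rewrite /pair_mass; field; rewrite !gt_eqF.
  have d2 : 0 <= (lam ^+ 2 * (n%:R * pair_mass f i))^-1.
    by rewrite d1 divr_ge0 ?mulr_ge0 ?sqr_ge0 ?ltW.
  rewrite /C1 div1r invr_ge0 addr_ge0//= lef_pV2 ?posrE ?ltr_pwDl//.
  rewrite lerD2l d1 ler_pM2l// lef_pV2 ?posrE ?mulr_gt0 ?exprn_gt0//.
  by rewrite ler_pM2l ?mulr_gt0 ?exprn_gt0// f_even_ge.
have [C10 C1le] := andP C1i; have [C20 C2le] := andP C2.
set C2' := 1 - _ in C20 C2le *.
have rhs0 : 0 <= L i / (1 + (lam ^+ 2 * (n%:R * pair_mass f i))^-1) / ln 2.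
  by rewrite !divr_ge0 ?(ltW ln2_gt0)//; rewrite -invr_ge0 (le_trans C10).
(* a term of negative sign may be dropped, the constant being nonnegative *)
have [X0|X0] := leP (1 / 2 * log2 (x i) - eps) 0.
  by apply: le_trans rhs0; rewrite mulr_ge0_le0// mulr_ge0.
apply: (@le_trans _ _ (C1 * (1 / 2 * log2 (x i) - eps))).
  by rewrite ler_pM2r// ler_piMr.
apply: (@le_trans _ _ (C1 * (L i / ln 2))).
  rewrite ler_wpM2l// (@le_trans _ _ (1 / 2 * log2 (x i)))//.
    by rewrite gerBl ltW.
  rewrite /log2 mulrA ler_pM2r ?invr_gt0// div1r /L le_max lexx orbT//.
by rewrite [leRHS]mulrAC [leRHS]mulrC ler_wpM2r// divr_ge0// ltW.
Qed.
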